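(* Let $n\ge 0$ and let $G$ be an $n$-quasimonophobic graph. Then $$H_n^{[n]}(G)=C_n^{[n]}(G)/\!\sim\;\cong\; C_n^{cell}(CW^\Box(G)).$$
   Context: Graphs are simple and undirected (no loops, no multiple edges). A graph map $f\colon G\to G'$ is a map of vertex sets sending every edge to an edge or to a single vertex; its image $\operatorname{Im}(f)$ is the subgraph of $G'$ with vertex set $f(V(G))$ and only those edges of $G'$ that are images of edges of $G$. $I^n$ denotes the discrete $n$-cube graph, with vertex set $\{0,1\}^n$, two vertices being adjacent iff they differ in exactly one coordinate ($I^0$ is a single vertex). A singular $n$-cube in $G$ is a graph map $\sigma\colon I^n\to G$; it is injective if it is injective on vertices. For $1\le i\le n$, $f_i^-\sigma$ and $f_i^+\sigma$ are the singular $(n-1)$-cubes (the faces of $\sigma$) obtained by fixing the $i$-th coordinate equal to $0$ and $1$ respectively. $\sigma$ is degenerate if $f_i^-\sigma=f_i^+\sigma$ for some $i$. Let $Q_n(G)$ be the free abelian group on singular $n$-cubes, with $\partial_n\sigma=\sum_{i=1}^n(-1)^i(f_i^-\sigma-f_i^+\sigma)$, let $D_*(G)\subseteq Q_*(G)$ be the subcomplex generated by degenerate cubes, and $C_*(G)=Q_*(G)/D_*(G)$. The degree of a singular $n$-cube $\sigma$ is the largest dimension $k$ of an injective face of $\sigma$ (faces of all dimensions $0\le k\le n$, including $\sigma$ itself, obtained by fixing $n-k$ of the coordinates). $C_n^k(G)\le C_n(G)$ is the subgroup generated by the nondegenerate singular $n$-cubes of degree at most $k$ (with $C_n^{-1}(G)=0$);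 for each $k$ this gives a subcomplex $C_*^k(G)$. Put $C_*^{[k]}(G)=C_*^k(G)/C_*^{k-1}(G)$ with induced boundary $\partial^{[k]}$, and $H_n^{[k]}(G)=H_n(C_*^{[k]}(G))$. Note $C_n^{[n]}(G)$ is free abelian on the injective singular $n$-cubes and $C_{n-1}^{[n]}(G)=0$, so $H_n^{[n]}(G)=C_n^{[n]}(G)/\partial^{[n]}_{n+1}(C_{n+1}^{[n]}(G))$. Let $T_i\colon I^n\to I^n$ be the reflection $t_i\mapsto 1-t_i$ of the $i$-th coordinate, and $T_{i,j}$ ($i<j$) the swap of the $i$-th and $j$-th coordinates. The equivalence relation $\sim$ on $C_n^{[n]}(G)$ is the one generated by declaring $\sigma\sim(-1)^{[\sigma,\gamma]}\gamma$ for injective singular $n$-cubes $\sigma,\gamma$ with $\operatorname{Im}(\sigma)=\operatorname{Im}(\gamma)$, where $[\sigma,\gamma]$ is the minimal number of factors of the form $T_i$, $T_{i,j}$ in a composition expressing $\sigma$ in terms of $\gamma$ (i.e. $\sigma=\gamma\circ(\text{composition})$); $C_n^{[n]}(G)/\!\sim$ is the quotient of the abelian group $C_n^{[n]}(G)$ by these relations. An $n$-cube in $G$ is a subgraph isomorphic to $I^n$; it is rigid if it is an induced subgraph of $G$. A singular $n$-cube is supported by an $n$-cube $Q$ if its image equals $Q$. A rigid $n$-cube $Q$ in $G$ is quasimonophobic if, whenever a noninjective singular $(n+1)$-cube in $G$ has a face $f_i^{\pm}$ supported by $Q$, it has at least one additional face (for a different choice of index and sign) supported by $Q$. $G$ is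 $n$-quasimonophobic if every $n$-cube in $G$ is rigid and quasimonophobic. $CW^\Box(G)$ is the CW complex obtained by filling in the cubes of $G$: its $n$-cells are solid $n$-cubes in bijection with the subgraphs of $G$ isomorphic to $I^n$, and the faces of the cell of a subgraph $D\cong I^n$ are identified with the cells of the corresponding $(n-1)$-cube subgraphs of $D$. $C_*^{cell}$ denotes integral cellular chains. *)

(* Defs.v *)
From HB Require Import structures.
From mathcomp Require Import all_boot all_order all_algebra.
From mathcomp Require Import boolp classical_sets.
From mathcomp Require Import zify ring perm.
From mathcomp.multinomials Require Import freeg.

Set Implicit Arguments.
Unset Strict Implicit.
Unset Printing Implicit Defensive.

Import Order.TTheory GRing.Theory Num.Theory.

Local Open Scope classical_set_scope.
Local Open Scope quotient_scope.
Local Open Scope ring_scope.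

Definition sub_of_pred (V : zmodType) (p : V -> bool) (h : zmod_closed p) :
    zmodClosed V :=
  HB.pack_for (zmodClosed V) p (GRing.isZmodClosed.Build V p h).

Section Generated.
Variables (V : zmodType) (S : set V).

Definition gen_pred (x : V) : bool :=
  `[< forall P : zmodClosed V, (forall y, S y -> y \in P) -> x \in P >].

Lemma gen_closed : zmod_closed gen_pred.
Proof.
split=> [|x y /asboolP Sx /asboolP Sy].
  by apply/asboolP=> P _; apply: rpred0.
by apply/asboolP=> P SP; rewrite rpredB ?Sx ?Sy.
Qed.

(* The subgroup generated by [S]: the intersection of all subgroups
   containing [S]. *)
Definition gen_sub : zmodClosed V := sub_of_pred gen_closed.

Lemma gen_subP x : reflect
  (forall P : zmodClosed V, (forall y, S y -> y \in P) -> x \in P)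
  (x \in gen_sub).
Proof. exact: asboolP. Qed.

Lemma mem_gen_sub x : S x -> x \in gen_sub.
Proof. by move=> Sx; apply/gen_subP=> P; apply. Qed.
End Generated.

Section Preimage.
Variables (V W : zmodType) (f : {additive V -> W}).

Lemma preim_closed (P : zmodClosed W) : zmod_closed (fun x => f x \in P).
Proof.
split=> [|x y]; first by rewrite unfold_in raddf0 rpred0.
by move=> Px Py; rewrite unfold_in raddfB rpredB.
Qed.

Definition preim_sub (P : zmodClosed W) : zmodClosed V :=
  sub_of_pred (preim_closed P).

Lemma ker_closed : zmod_closed (fun x => f x == 0).
Proof.
split=> [|x y]; first by rewrite unfold_in raddf0.
by move=> /eqP fx /eqP fy; rewrite unfold_in raddfB fx fy subrr.
Qed.

Definition ker_sub : zmodClosed V := sub_of_pred ker_closed.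

Lemma im_closed : zmod_closed (fun y => `[< exists x, f x = y >]).
Proof.
split=> [|x y]; first by apply/asboolP; exists 0; rewrite raddf0.
move=> /asboolP[u <-] /asboolP[v <-].
by apply/asboolP; exists (u - v); rewrite raddfB.
Qed.

Definition im_sub : zmodClosed W := sub_of_pred im_closed.
End Preimage.

Lemma gen_sub_ind (V W : zmodType) (f : {additive V -> W}) (S : set V)
    (P : zmodClosed W) :
  (forall y, S y -> f y \in P) -> forall x, x \in gen_sub S -> f x \in P.
Proof. by move=> SP x /gen_subP/(_ (preim_sub f P)); apply. Qed.

Section Subgroup.
Variables (V : zmodType) (P : zmodClosed V).

Definition subgroup := {x : V | x \in P}.
HB.instance Definition _ := SubType.on subgroup.
HB.instance Definition _ := [Choice of subgroup by <:].
HB.instance Definition _ := [SubChoice_isSubZmodule of subgroup by <:].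

Definition incl : {additive subgroup -> V} := \val.
End Subgroup.

Section SubgroupMap.
Variables (V W : zmodType) (P : zmodClosed V) (P' : zmodClosed W).
Variables (f : {additive V -> W}) (fP : forall x, x \in P -> f x \in P').

Definition sub_map_fun (x : subgroup P) : subgroup P' :=
  exist _ (f (val x)) (fP (valP x)).

Lemma sub_map_is_zmod_morphism : zmod_morphism sub_map_fun.
Proof. by move=> x y; apply: val_inj; rewrite /= !raddfB. Qed.
HB.instance Definition _ := GRing.isZmodMorphism.Build (subgroup P)
  (subgroup P') sub_map_fun sub_map_is_zmod_morphism.

Definition sub_map : {additive subgroup P -> subgroup P'} := sub_map_fun.
End SubgroupMap.

Section Quotient.
Variables (V : zmodType) (P : zmodClosed V).

Definition quotient := Quotient.quot P.
HB.instance Definition _ := GRing.Zmodule.on quotient.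
HB.instance Definition _ := Quotient.on quotient.

Definition proj_fun (x : V) : quotient := \pi_(Quotient.quot P) x.

Lemma proj_is_zmod_morphism : zmod_morphism proj_fun.
Proof. by move=> x y; rewrite /proj_fun raddfB. Qed.
HB.instance Definition _ :=
  GRing.isZmodMorphism.Build V quotient proj_fun proj_is_zmod_morphism.

Definition proj : {additive V -> quotient} := proj_fun.

Lemma proj_eq0 x : (proj x == 0) = (x \in P).
Proof.
rewrite -[x in RHS]subr0 Quotient.idealrBE.
by rewrite -[0 in LHS](raddf0 proj).
Qed.

Lemma proj_surj (y : quotient) : exists x, y = proj x.
Proof. by exists (repr (y : Quotient.quot P)); rewrite /= /proj_fun reprK. Qed.
End Quotient.

Section QuotientMap.
Variables (V W : zmodType) (P : zmodClosed V) (P' : zmodClosed W).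
Variables (f : {additive V -> W}) (fP : forall x, x \in P -> f x \in P').

Definition quot_map_fun (x : quotient P) : quotient P' :=
  proj P' (f (repr (x : Quotient.quot P))).

Lemma quot_mapE x : quot_map_fun (proj P x) = proj P' (f x).
Proof.
apply/eqP; rewrite -subr_eq0 -raddfB proj_eq0 -raddfB fP //.
by rewrite -proj_eq0 raddfB /= /proj_fun reprK subrr.
Qed.

Lemma quot_map_is_zmod_morphism : zmod_morphism quot_map_fun.
Proof.
move=> x y; have [u ->] := proj_surj x; have [v ->] := proj_surj y.
by rewrite -raddfB !quot_mapE !raddfB.
Qed.
HB.instance Definition _ := GRing.isZmodMorphism.Build (quotient P)
  (quotient P') quot_map_fun quot_map_is_zmod_morphism.

Definition quot_map : {additive quotient P -> quotient P'} := quot_map_fun.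
End QuotientMap.

(* The complex is extended by 0 in negative degrees. Since [0.-1] is [0], the
   boundary out of degree 0 is recorded as the zero endomorphism of the group
   in degree 0; its kernel is the whole group, as it should. *)
Record complex := Complex {
  chain :> nat -> zmodType;
  bd : forall n, {additive chain n -> chain n.-1};
  bd0 : forall x, bd 0 x = 0;
  bd_bd : forall n (x : chain n), bd n.-1 (bd n x) = 0
}.

Record subcomplex (X : complex) := Subcomplex {
  subchain :> forall n, zmodClosed (X n);
  subchain_bd : forall n x, x \in subchain n -> bd X n x \in subchain n.-1
}.

Section ComplexOperations.
Variables (X : complex) (A : subcomplex X).

Definition sub_complex : complex.
Proof.
exists (fun n => subgroup (A n))
  (fun n => sub_map (@subchain_bd X A n)).
- by move=> x; apply: val_inj; rewrite /= bd0.
- by move=> n x; apply: val_inj; rewrite /= bd_bd.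
Defined.

Definition quot_complex : complex.
Proof.
exists (fun n => quotient (A n))
  (fun n => quot_map (@subchain_bd X A n)).
- move=> x; have [y ->] := proj_surj x.
  by rewrite /= quot_mapE ?bd0 ?raddf0 //; apply: subchain_bd.
- move=> n x; have [y ->] := proj_surj x.
  by rewrite /= !quot_mapE ?bd_bd ?raddf0 //; apply: subchain_bd.
Defined.
End ComplexOperations.

(* [rel_complex A B] is the quotient complex A/B, for subcomplexes B <= A. *)
Section RelativeComplex.
Variables (X : complex) (A B : subcomplex X).

Definition trace_subcomplex : subcomplex (sub_complex A).
Proof.
exists (fun n => preim_sub (incl (A n)) (B n)).
by move=> n x; apply: subchain_bd.
Defined.

Definition rel_complex := quot_complex trace_subcomplex.
End RelativeComplex.

Section Homology.
Variables (X : complex) (n : nat).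

Definition cycles : zmodType := subgroup (ker_sub (bd X n)).

Definition cycle_val : {additive cycles -> X n} := incl (ker_sub (bd X n)).

Definition boundaries : zmodClosed cycles :=
  preim_sub cycle_val (im_sub (bd X n.+1)).

Definition homology : zmodType := quotient boundaries.

Definition homology_class : {additive cycles -> homology} := proj boundaries.
End Homology.

Arguments cycle_val {X n}.
Arguments homology_class {X n}.

Record graph := Graph {
  vertex :> choiceType;
  adj : rel vertex;
  adj_sym : symmetric adj;
  adj_irrefl : irreflexive adj
}.

Definition graph_map (G H : graph) (f : G -> H) : Prop :=
  forall x y, adj x y -> f x = f y \/ adj (f x) (f y).

Section Subgraph.
Variable G : graph.

(* A set of vertices and a set of (both orientations of) edges. *)
Definition is_subgraph (p : set G * set (G * G)) : Prop :=
  (forall x y, p.2 (x, y) -> [/\ adj x y, p.1 x & p.1 y]) /\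
  (forall x y, p.2 (x, y) -> p.2 (y, x)).

Definition subgraph := {p : set G * set (G * G) | `[< is_subgraph p >]}.
HB.instance Definition _ := SubType.on subgraph.
HB.instance Definition _ := [Choice of subgraph by <:].

Definition sub_vertices (D : subgraph) : set G := (val D).1.
Definition sub_edges (D : subgraph) : set (G * G) := (val D).2.

Definition sub_incl (D E : subgraph) : Prop :=
  sub_vertices D `<=` sub_vertices E /\ sub_edges D `<=` sub_edges E.

Definition induced (D : subgraph) : Prop :=
  forall x y, sub_vertices D x -> sub_vertices D y -> adj x y ->
    sub_edges D (x, y).

Definition isomorphic_to (D : subgraph) (H : graph) : Prop :=
  exists f : H -> G, [/\ injective f, sub_vertices D = range f &
    forall x y, adj x y <-> sub_edges D (f x, f y)].
End Subgraph.

Section Image.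
Variables (H G : graph) (f : H -> G).

Definition image_pair : set G * set (G * G) :=
  (range f,
   [set p | adj p.1 p.2 /\ exists x y, [/\ adj x y, f x = p.1 & f y = p.2]]).

Lemma image_is_subgraph : is_subgraph image_pair.
Proof.
split=> x y [/= xy [u [v [uv fu fv]]]].
  by split; rewrite // -?fu -?fv; apply: imageT.
by split=> /=; [rewrite adj_sym | exists v, u; rewrite adj_sym].
Qed.

Definition image_graph : subgraph G :=
  exist _ image_pair (asboolT image_is_subgraph).
End Image.

Notation bits n := {ffun 'I_n -> bool}.

Section Cube.
Variable n : nat.

Definition cube_adj (x y : bits n) : bool :=
  #|[pred i | x i != y i]| == 1%N.

Lemma cube_adj_sym : symmetric cube_adj.
Proof.
move=> x y; congr (_ == _); apply: eq_card => i.
by rewrite !inE eq_sym.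
Qed.

Lemma cube_adj_irrefl : irreflexive cube_adj.
Proof.
by move=> x; apply/negbTE; rewrite neq_ltn eq_card0 // => i; rewrite !inE eqxx.
Qed.

Definition cube : graph := Graph cube_adj_sym cube_adj_irrefl.

Definition singular_cube (G : graph) :=
  {s : {ffun bits n -> G} | `[< @graph_map cube G s >]}.
End Cube.

HB.instance Definition _ n G := SubType.on (singular_cube n G).
HB.instance Definition _ n G := [Choice of singular_cube n G by <:].

Definition cube_fun n G (s : singular_cube n G) : cube n -> G := val s.
Coercion cube_fun : singular_cube >-> Funclass.

(* The inclusion of the face [x_i = b]; the remaining coordinates are
   enumerated by [fintype.lift i]. *)
Definition cube_ins n (i : 'I_n) (b : bool) (x : cube n.-1) : cube n :=
  [ffun j => if unlift i j is Some k then x k else b].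

Lemma face_graph_map n G (i : 'I_n) b (s : singular_cube n G) :
  @graph_map (cube n.-1) G [ffun x => s (cube_ins i b x)].
Proof.
case: s => s /[dup] /asboolP sG Ps x y xy; rewrite !ffunE /=; apply: sG.
rewrite /= /cube_adj -(eqP xy) -(card_image (@lift_inj _ i)).
apply/eqP/eq_card => j; rewrite inE !ffunE; apply/idP/fintype.imageP.
  by case: unliftP => [k ->|_]; rewrite ?eqxx //; exists k.
by case=> k kxy ->; rewrite liftK.
Qed.

Definition face n G (i : 'I_n) (b : bool) (s : singular_cube n G) :
    singular_cube n.-1 G :=
  exist _ [ffun x => s (cube_ins i b x)] (asboolT (face_graph_map i b s)).

Definition degenerate n G (s : singular_cube n G) : Prop :=
  exists i, face i false s = face i true s.

(* The face of [I^n] through [a] with free coordinates [A]. *)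
Definition cube_face n (A : {set 'I_n}) (a : bits n) : {pred bits n} :=
  [pred x : bits n | [forall i, (i \notin A) ==> (x i == a i)]].

(* The cube itself is the face with [A] the set of all coordinates, and its
   vertices are the faces with [A] empty. *)
Definition degree n G (s : singular_cube n G) : nat :=
  \max_(p : {set 'I_n} * bits n | dinjectiveb s (cube_face p.1 p.2)) #|p.1|.

Section Free.
Variables (K : choiceType) (W : lmodType int) (f : K -> W).

Definition fgen (x : K) : {freeg K / int} := << x >>.

Definition flift_fun (x : {freeg K / int}) : W := fglift f x.

Lemma flift_is_zmod_morphism : zmod_morphism flift_fun.
Proof. exact: lift_is_additive. Qed.
HB.instance Definition _ := GRing.isZmodMorphism.Build
  {freeg K / int} W flift_fun flift_is_zmod_morphism.

(* The homomorphism extending [f] to the free abelian group on [K]. *)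
Definition flift : {additive {freeg K / int} -> W} := flift_fun.

Lemma fliftE x : flift (fgen x) = f x.
Proof. by rewrite /= /flift_fun liftU scale1r. Qed.
End Free.

Lemma freeg_sub_ind (K : choiceType) (P : zmodClosed {freeg K / int}) :
  (forall x, fgen x \in P) -> forall x, x \in P.
Proof.
move=> KP x; elim/freeg_ind_dom0: x => [|k x D _ _ PD]; first exact: rpred0.
have -> : << k *g x >> = fgen x *~ k by rewrite /fgen freegU_mulz intz.
by rewrite rpredD ?rpredMz.
Qed.

Lemma freeg_double_eq0 (K : choiceType) (x : {freeg K / int}) :
  x = - x -> x = 0.
Proof.
move=> xN; apply/eqP/freeg_eqP => z; rewrite coeff0.
by have := congr1 (coeff z) xN; rewrite coeffN; lia.
Qed.

Section Cubical.
Variable G : graph.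

Definition Q_chain n : zmodType := {freeg (singular_cube n G) / int}.

(* Coordinates are numbered from 0, whence the sign [(-1) ^+ i.+1]. *)
Definition bd_cube n (s : singular_cube n G) : Q_chain n.-1 :=
  \sum_(i < n) (fgen (face i false s) - fgen (face i true s)) *~ (-1) ^+ i.+1.

Definition Q_bd n : {additive Q_chain n -> Q_chain n.-1} :=
  flift (@bd_cube n).

(* The face with [x_i = b] and then [x_j = c] is also the face with
   [x_i' = c] and then [x_j' = b], where [(i', j') := face_swap (i, j)]. *)
Definition face_swap n (p : 'I_n * 'I_n.-1) : 'I_n * 'I_n.-1 :=
  let i' := fintype.lift p.1 p.2 in (i', odflt p.2 (unlift i' p.1)).

Lemma face_swapE n (p : 'I_n * 'I_n.-1) :
  fintype.lift (face_swap p).1 (face_swap p).2 = p.1.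
Proof.
case: p => i j; rewrite /face_swap /=.
case: unliftP => [k <- //|ii']; have := neq_lift i j.
by rewrite -ii' eqxx.
Qed.

Lemma face_swapK n : involutive (@face_swap n).
Proof.
move=> p; rewrite {1}/face_swap face_swapE.
by rewrite {1}/face_swap /= liftK; case: p.
Qed.

Lemma face_swap_sign n (p : 'I_n * 'I_n.-1) (q := face_swap p) :
  (-1) ^+ q.1.+1 * (-1) ^+ q.2.+1 = - ((-1) ^+ p.1.+1 * (-1) ^+ p.2.+1) :> int.
Proof.
have q2 := face_swapE p; rewrite -/q in q2.
have q1 : q.1 = fintype.lift p.1 p.2 by [].
clearbody q; move: q1 q2 => /(congr1 val)/= + /(congr1 val)/=.
rewrite /bump => q1 q2.
have [[-> ->]|[-> ->]] : (q.1 = p.2.+1 :> nat /\ q.2 = p.1 :> nat) \/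
    (q.1 = p.2 :> nat /\ p.1 = q.2.+1 :> nat) by lia.
  by rewrite !exprS; ring.
by rewrite !exprS; ring.
Qed.

Lemma cube_ins_swap n (p : 'I_n * 'I_n.-1) (q := face_swap p) b c x :
  cube_ins p.1 b (cube_ins p.2 c x) = cube_ins q.1 c (cube_ins q.2 b x).
Proof.
have q2 := face_swapE p; rewrite -/q in q2.
have q1 : q.1 = fintype.lift p.1 p.2 by [].
clearbody q; apply/ffunP => k; rewrite !ffunE.
case: (unliftP p.1 k) => [k1 ->|->].
  rewrite !ffunE; case: (unliftP p.2 k1) => [k2 ->|->].
    have -> : fintype.lift p.1 (fintype.lift p.2 k2) =
        fintype.lift q.1 (fintype.lift q.2 k2).
      apply: val_inj; move/(congr1 val): q1; move/(congr1 val): q2 => /=.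
      by rewrite /bump; lia.
    by rewrite liftK ffunE liftK.
  by rewrite -q1 unlift_none.
by rewrite -{1}q2 liftK ffunE unlift_none.
Qed.

Lemma face_swap_face n (p : 'I_n * 'I_n.-1) (q := face_swap p) b c
    (s : singular_cube n G) :
  face p.2 c (face p.1 b s) = face q.2 b (face q.1 c s).
Proof.
apply: val_inj; apply/ffunP => x.
by rewrite !ffunE /cube_fun /= !ffunE cube_ins_swap.
Qed.

Lemma Q_bd0 (x : Q_chain 0) : Q_bd 0 x = 0.
Proof.
apply/eqP; change (x \in ker_sub (Q_bd 0)); apply: freeg_sub_ind => s.
by apply/eqP; rewrite fliftE /bd_cube big_ord0.
Qed.

Lemma Q_bd_bd n (x : Q_chain n) : Q_bd n.-1 (Q_bd n x) = 0.
Proof.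
apply/eqP; change (x \in preim_sub (Q_bd n) (ker_sub (Q_bd n.-1))).
apply: freeg_sub_ind => s; apply/eqP; rewrite fliftE /bd_cube.
pose T (p : 'I_n * 'I_n.-1) b c : Q_chain n.-1.-1 :=
  fgen (face p.2 c (face p.1 b s)).
pose F p := (T p false false - T p false true - (T p true false - T p true true))
  *~ ((-1) ^+ p.1.+1 * (-1) ^+ p.2.+1).
have -> : Q_bd n.-1 (bd_cube s) = \sum_p F p.
  rewrite -(pair_bigA _ (fun i j => F (i, j))) raddf_sum; apply: eq_bigr => i _.
  rewrite raddfMz raddfB !fliftE /bd_cube -sumrB mulrz_suml.
  by apply: eq_bigr => j _; rewrite /F -mulrzBl -mulrzA [_ * (-1) ^+ i.+1]mulrC.
apply: freeg_double_eq0; rewrite [LHS](reindex_inj (inv_inj (@face_swapK n))).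
rewrite -sumrN; apply: eq_bigr => p _; rewrite /F face_swap_sign mulrNz.
rewrite /T -!face_swap_face; congr (- (_ *~ _)).
by rewrite !opprD !opprK addrACA.
Qed.

Definition Q_complex : complex := Complex Q_bd0 Q_bd_bd.

Lemma Q_bdE n (s : singular_cube n G) :
  bd Q_complex n (fgen s) =
  \sum_(i < n) (fgen (face i false s) - fgen (face i true s)) *~ (-1) ^+ i.+1.
Proof. exact: fliftE. Qed.
End Cubical.

Section DegreeFiltration.
Variable G : graph.

Lemma degenerate_face n (i j : 'I_n) b (s : singular_cube n G) :
  face i false s = face i true s -> j != i -> degenerate (face j b s).
Proof.
move=> si; case: (unliftP j i) => [k ik _|->]; last by rewrite eqxx.
by exists k; rewrite !(@face_swap_face _ _ (j, k)) /face_swap /= -ik si.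
Qed.

Definition degenerate_chains n : zmodClosed (Q_complex G n) :=
  gen_sub [set fgen s | s in @degenerate n G].

Lemma degenerate_chains_bd n x :
  x \in degenerate_chains n -> bd (Q_complex G) n x \in degenerate_chains n.-1.
Proof.
apply: gen_sub_ind => _ [s [i si] <-]; rewrite Q_bdE.
apply: rpred_sum => j _; apply: rpredMz.
have [->|ji] := eqVneq j i; first by rewrite si subrr; apply: rpred0.
have dj b : fgen (face j b s) \in degenerate_chains n.-1.
  by apply: mem_gen_sub; exists (face j b s) => //; apply: degenerate_face si ji.
by apply: rpredB.
Qed.

Definition D_subcomplex : subcomplex (Q_complex G) :=
  Subcomplex degenerate_chains_bd.

Definition C_complex : complex := quot_complex D_subcomplex.

Definition cube_class n (s : singular_cube n G) : C_complex n :=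
  proj (D_subcomplex n) (fgen s).

Lemma C_bdE n (s : singular_cube n G) :
  bd C_complex n (cube_class s) =
  \sum_(i < n) (cube_class (face i false s) - cube_class (face i true s))
    *~ (-1) ^+ i.+1.
Proof.
rewrite [LHS]quot_mapE; last exact: subchain_bd.
rewrite Q_bdE raddf_sum; apply: eq_bigr => i _.
by rewrite raddfMz raddfB.
Qed.

Lemma degree_face n (i : 'I_n) b (s : singular_cube n G) :
  (degree (face i b s) <= degree s)%N.
Proof.
apply/bigmax_leqP => -[A a] /= /dinjectiveP inj_s.
pose p : {set 'I_n} * bits n := (fintype.lift i @: A, cube_ins i b a).
have liA k : (fintype.lift i k \in p.1) = (k \in A).
  by rewrite mem_imset //; apply: lift_inj.
have iA : i \notin p.1.
  by apply/imsetP => -[k _ /eqP]; rewrite (negbTE (neq_lift i k)).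
rewrite -(card_imset _ (@lift_inj _ i)).
apply: (@leq_bigmax_cond _ _ (fun q : {set 'I_n} * bits n => #|q.1|) p).
apply/dinjectiveP => x y /forallP xA /forallP yA sxy.
have insE (z : bits n) : (forall k, (k \notin p.1) ==> (z k == p.2 k)) ->
    z = cube_ins i b [ffun k => z (fintype.lift i k)].
  move=> zA; apply/(@ffunP _ (fun=> bool)) => k; rewrite ffunE.
  case: unliftP => [l ->|->].
    by rewrite ffunE.
  by have /implyP/(_ iA)/eqP -> := zA i; rewrite ffunE unlift_none.
have restr (z : bits n) : (forall k, (k \notin p.1) ==> (z k == p.2 k)) ->
    [ffun k => z (fintype.lift i k)] \in cube_face A a.
  move=> zA; apply/forallP => k; apply/implyP => kA; rewrite ffunE.
  by have /implyP := zA (fintype.lift i k); rewrite liA ffunE liftK; apply.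
rewrite (insE x) // (insE y) //; congr cube_ins.
apply: inj_s; [exact: restr|exact: restr|].
by rewrite /cube_fun /= !ffunE -!insE.
Qed.

Lemma degree_le n (s : singular_cube n G) : (degree s <= n)%N.
Proof.
by apply/bigmax_leqP => -[A a] _ /=; rewrite -[leqRHS]card_ord max_card.
Qed.

(* For [k = -1] there are no generators, and the subgroup is 0. *)
Definition degree_chains (k : int) n : zmodClosed (C_complex n) :=
  gen_sub [set x | exists s : singular_cube n G,
    [/\ ~ degenerate s, ((degree s)%:Z <= k)%R & x = cube_class s]].

Lemma cube_class_degree k n (s : singular_cube n G) :
  ((degree s)%:Z <= k)%R -> cube_class s \in degree_chains k n.
Proof.
move=> sk; have [sD|sD] := pselect (degenerate s).
  suff /eqP -> : cube_class s == 0 by rewrite rpred0.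
  by rewrite proj_eq0; apply: mem_gen_sub; exists s.
by apply: mem_gen_sub; exists s.
Qed.

Lemma degree_chains_bd k n x :
  x \in degree_chains k n -> bd C_complex n x \in degree_chains k n.-1.
Proof.
apply: gen_sub_ind => _ [s [_ sk ->]].
rewrite C_bdE; apply: rpred_sum => i _; apply: rpredMz.
by apply: rpredB; apply: cube_class_degree;
  rewrite (le_trans _ sk) // lez_nat degree_face.
Qed.

Definition C_subcomplex (k : int) : subcomplex C_complex :=
  Subcomplex (@degree_chains_bd k).

(* [C_graded k] is the complex C^[k] = C^k / C^(k-1). *)
Definition C_graded (k : int) : complex :=
  rel_complex (C_subcomplex k) (C_subcomplex (k - 1)).

Lemma cube_class_top n (s : singular_cube n G) :
  cube_class s \in C_subcomplex n n.
Proof. by apply: cube_class_degree; rewrite lez_nat degree_le. Qed.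

Definition graded_class n (s : singular_cube n G) : C_graded n n :=
  proj (trace_subcomplex (C_subcomplex n) (C_subcomplex (n%:Z - 1)) n)
    (exist _ (cube_class s) (cube_class_top s)).
End DegreeFiltration.

Definition cube_reflect n (i : 'I_n) (x : bits n) : bits n :=
  [ffun k => if k == i then ~~ x k else x k].

Definition cube_swap n (i j : 'I_n) (x : bits n) : bits n :=
  [ffun k => x (tperm i j k)].

Inductive cube_move n : Type :=
  | Reflect of 'I_n
  | Swap (i j : 'I_n) of (i < j)%N.

Definition move_fun n (m : cube_move n) : bits n -> bits n :=
  match m with
  | Reflect i => cube_reflect i
  | Swap i j _ => cube_swap i j
  end.

Definition moves_fun n (w : seq (cube_move n)) : bits n -> bits n :=
  foldr (fun m f => move_fun m \o f) id w.

(* [bracket s t m] is the graph of the partial function [s, t] = m; when [s]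
   and [t] are injective with the same image, such an [m] exists since the two
   differ by an automorphism of the cube. *)
Definition bracket n G (s t : singular_cube n G) (m : nat) : Prop :=
  (exists2 w, size w = m & s =1 t \o moves_fun w) /\
  (forall w, s =1 t \o moves_fun w -> (m <= size w)%N).

Definition cube_relations (n : nat) (G : graph) : set (C_graded G n n) :=
  [set x | exists (s t : singular_cube n G) (m : nat),
    [/\ injective s, injective t, image_graph s = image_graph t,
        bracket s t m &
        x = graded_class s - graded_class t *~ (-1) ^+ m]].

Definition C_mod_sim (n : nat) (G : graph) : zmodType :=
  quotient (gen_sub (@cube_relations n G)).

Definition sim_class (n : nat) (G : graph) :
    {additive C_graded G n n -> C_mod_sim n G} :=
  proj (gen_sub (@cube_relations n G)).

Arguments sim_class {n G}.

Section Cubes.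
Variables (G : graph) (n : nat).

Definition is_cube (D : subgraph G) : Prop := isomorphic_to D (cube n).

Definition supported_by (s : singular_cube n G) (D : subgraph G) : Prop :=
  image_graph s = D.
End Cubes.

Definition quasimonophobic_cube G n (D : subgraph G) : Prop :=
  forall (s : singular_cube n.+1 G) (i : 'I_n.+1) (b : bool),
    ~ injective s -> supported_by (face i b s : singular_cube n G) D ->
    exists (j : 'I_n.+1) (c : bool),
      (j, c) != (i, b) /\ supported_by (face j c s : singular_cube n G) D.

Definition quasimonophobic n (G : graph) : Prop :=
  forall D : subgraph G, is_cube n D -> induced D /\ quasimonophobic_cube n D.

(* Only the combinatorial data of a CW complex are kept: its cells and which
   n-cells are faces of which (n+1)-cells. *)
Record cell_complex := CellComplex {
  cell : nat -> choiceType;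
  facet : forall n, cell n -> cell n.+1 -> Prop
}.

(* The group of integral cellular n-chains is free abelian on the n-cells. *)
Definition cellular_chains (X : cell_complex) (n : nat) : zmodType :=
  {freeg (cell X n) / int}.

Definition CW_cell G n := {D : subgraph G | `[< is_cube n D >]}.
HB.instance Definition _ G n := SubType.on (CW_cell G n).
HB.instance Definition _ G n := [Choice of CW_cell G n by <:].

Definition CW_box (G : graph) : cell_complex :=
  @CellComplex (fun n => CW_cell G n : choiceType)
    (fun n D E => sub_incl (val D) (val E)).

(* Main.v *)
(** The sign of an automorphism of the n-cube (a signed permutation of the
    coordinates) is the parity of the length of any word of reflections and
    swaps expressing it.  Fix one parametrisation of each n-cube of G.  An
    injective singular cube then has a sign relative to the parametrisation of
    its image, and sending it to the signed cell of its image identifies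
    C_n^[n](G)/~ with the cellular chains.

    It remains to see that the relations are exactly the boundaries.  If a
    noninjective (n+1)-cube s has two facets with the same image Q in different
    directions i and j, then s folds one onto the other, no third direction
    contributes Q, and the facets in directions i and j cancel in pairs.
    Otherwise quasimonophobicity forces the facets with image Q to be two
    opposite ones; as Q is induced, they differ by an automorphism of the cube
    moving every vertex by at most one edge.  Such an automorphism is the
    identity, a quarter turn of two coordinates, or a reflection: the first two
    have sign +1, and the last would produce facets with image Q in another
    direction.  Conversely, a cube plus its reflection bounds a folded cube, a
    cube minus its quarter turn bounds the homotopy between them, and a swap is
    the composite of a reflection and a quarter turn. *)

Require Import Defs.
From HB Require Import structures.
From mathcomp Require Import all_boot all_order all_algebra.
From mathcomp Require Import boolp classical_sets.
From mathcomp Require Import zify perm.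
From mathcomp.multinomials Require Import freeg.

Set Implicit Arguments.
Unset Strict Implicit.
Unset Printing Implicit Defensive.

Import Order.TTheory GRing.Theory Num.Theory.
Local Open Scope ring_scope.

(** * Automorphisms of the cube *)

Section Reflections.
Variable n : nat.
Implicit Types (x y c d : bits n) (i j : 'I_n) (p q : 'S_n).

Lemma cube_reflectE i x k : cube_reflect i x k = x k (+) (k == i).
Proof. by rewrite ffunE; case: (k == i); rewrite ?addbT ?addbF. Qed.

Lemma cube_reflectK i : involutive (cube_reflect i).
Proof. by move=> x; apply/ffunP => k; rewrite !cube_reflectE addbK. Qed.

Lemma cube_reflectC i j x :
  cube_reflect i (cube_reflect j x) = cube_reflect j (cube_reflect i x).
Proof. by apply/ffunP => k; rewrite !cube_reflectE addbAC. Qed.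

Lemma cube_reflect_dir_inj x i j : cube_reflect i x = cube_reflect j x -> i = j.
Proof.
move=> /ffunP/(_ i); rewrite !cube_reflectE eqxx.
by case: eqVneq => //; case: (x i).
Qed.

Lemma cube_adjP x y : reflect (exists i, y = cube_reflect i x) (cube_adj x y).
Proof.
rewrite /cube_adj; apply: (iffP card1P) => -[i xy]; exists i.
  apply/ffunP => k; rewrite cube_reflectE; have := xy k; rewrite !inE.
  by case: (x k); case: (y k); case: (k == i).
move=> k; rewrite !inE xy cube_reflectE.
by case: (x k); case: (k == i).
Qed.

Lemma cube_adj_reflect i x : cube_adj x (cube_reflect i x).
Proof. by apply/cube_adjP; exists i. Qed.

(** Induction on the number of coordinates in which [x] differs from [x0]. *)
Lemma cube_reflect_ind (P : bits n -> Prop) x0 :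
  P x0 -> (forall i x, P x -> P (cube_reflect i x)) -> forall x, P x.
Proof.
move=> P0 PS x; move m: #|[pred k | x k != x0 k]| => d.
elim: d x m => [|d IH] x xd.
  suff -> : x = x0 by [].
  by apply/ffunP => k; apply/eqP; have /negbFE := card0_eq xd k.
have /card_gt0P[i] : (0 < #|[pred k | x k != x0 k]|)%N by rewrite xd.
rewrite inE => xi; rewrite -(cube_reflectK i x); apply/PS/IH.
apply: succn_inj; rewrite -xd [in RHS](cardD1 i) !inE xi; congr _.+1.
apply: eq_card => k; rewrite !inE cube_reflectE.
case: (eqVneq k i) => [->|_]; last by rewrite addbF.
by move: xi; case: (x i); case: (x0 i).
Qed.

(** Coordinates are precomposed with [p]; as [(p * q) k = q (p k)], composing such maps multiplies
    the permutations in the same order. *)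
Definition affine (p : 'S_n) (c : bits n) (x : bits n) : bits n :=
  [ffun k => x (p k) (+) c k].

(* The determinant of the signed permutation [affine p c], as an exponent of
   -1. *)
Definition affine_odd (p : 'S_n) (c : bits n) : bool :=
  odd_perm p (+) \big[addb/false]_k c k.

Definition ffalse : bits n := [ffun => false].
Definition fdelta i (b : bool) : bits n := [ffun k => (k == i) && b].

Lemma affine_comp p c q d x :
  affine p c (affine q d x) = affine (p * q) [ffun k => d (p k) (+) c k] x.
Proof. by apply/ffunP => k; rewrite !ffunE permM addbA. Qed.

Lemma affine_odd_comp p c q d :
  affine_odd (p * q) [ffun k => d (p k) (+) c k] =
  affine_odd p c (+) affine_odd q d.
Proof.
rewrite /affine_odd odd_permM.
have -> : \big[addb/false]_k [ffun k => d (p k) (+) c k] k =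
    \big[addb/false]_k d k (+) \big[addb/false]_k c k.
  rewrite [X in _ = X (+) _](reindex_inj (@perm_inj _ p)) -big_split.
  by apply: eq_bigr => k _; rewrite ffunE.
by do !case: (odd_perm _); do !case: (\big[_/_]_k _).
Qed.

Lemma affine_id x : affine 1 ffalse x = x.
Proof. by apply/ffunP => k; rewrite !ffunE perm1 addbF. Qed.

Lemma affine_odd_id : affine_odd 1 ffalse = false.
Proof. by rewrite /affine_odd odd_perm1 big1 // => k _; rewrite ffunE. Qed.

Lemma affine_reflect i : cube_reflect i =1 affine 1 (fdelta i true).
Proof.
by move=> x; apply/ffunP => k; rewrite cube_reflectE !ffunE perm1 andbT.
Qed.

Lemma big_fdelta i b : \big[addb/false]_k fdelta i b k = b.
Proof.
rewrite (bigD1 i) //= big1 ?ffunE ?eqxx ?addbF // => k.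
by rewrite ffunE; case: eqP.
Qed.

Lemma affine_odd_reflect i : affine_odd 1 (fdelta i true) = true.
Proof. by rewrite /affine_odd odd_perm1 big_fdelta. Qed.

Lemma affine_swap i j : cube_swap i j =1 affine (tperm i j) ffalse.
Proof. by move=> x; apply/ffunP => k; rewrite !ffunE addbF. Qed.

Lemma affine_odd_swap i j : i != j -> affine_odd (tperm i j) ffalse = true.
Proof.
by move=> ij; rewrite /affine_odd odd_tperm ij big1 // => k _; rewrite ffunE.
Qed.

(** If [p k != j], flipping coordinate [p k] of the constant vertex [b] stays in the facet, and
    coordinate [k] of the two images then tells [p k] from [q k]. At the one [k] with [p k = j], the
    roles of [p] and [q] are exchanged unless [q k = j] as well. *)
Lemma affine_inj_facet j b p c q d :
  (forall x, x j = b -> affine p c x = affine q d x) -> p = q /\ c = d.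
Proof.
move=> pq; suff pqE : p = q.
  subst q; split=> //; apply/ffunP => k.
  pose x : bits n := [ffun=> b].
  have /ffunP/(_ k) := pq x (ffunE _ _).
  by rewrite !ffunE => /addbI.
have aux p' c' q' d' :
    (forall x, x j = b -> affine p' c' x = affine q' d' x) ->
    forall k, p' k != j -> p' k = q' k.
  move=> pq' k pkj; apply/eqP/idPn => pqk.
  have yj : cube_reflect (p' k) [ffun=> b] j = b.
    by rewrite cube_reflectE ffunE eq_sym (negbTE pkj) addbF.
  have /ffunP/(_ k) := pq' _ yj.
  have /ffunP/(_ k) := pq' [ffun=> b] (ffunE _ _).
  rewrite !ffunE eqxx eq_sym (negbTE pqk) => <-.
  by rewrite addNb; case: (b (+) c' k).
apply/permP => k; have [pk|/(aux _ _ _ _ pq)//] := eqVneq (p k) j.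
have [qk|] := eqVneq (q k) j; first by rewrite pk qk.
by move=> /(aux q d p c) -> // x /pq.
Qed.

Lemma affine_inj p c q d : affine p c =1 affine q d -> p = q /\ c = d.
Proof.
move=> pq; have [j _|no_j] := pickP (@predT 'I_n).
  by apply: (@affine_inj_facet j false) => x _; apply: pq.
by split; [apply/permP | apply/ffunP] => k; have := no_j k.
Qed.

(** Every single move is odd, so the length of a word gives its sign. *)
Lemma moves_affine (w : seq (cube_move n)) :
  exists p c, moves_fun w =1 affine p c /\ affine_odd p c = odd (size w).
Proof.
elim: w => [|m w [p [c [wpc odd_w]]]].
  by exists 1%g, ffalse; split=> [x|]; rewrite /= ?affine_id ?affine_odd_id.
have [q [d [mqd odd_m]]] :
    exists q d, move_fun m =1 affine q d /\ affine_odd q d = true.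
  case: m => [i|i j ij].
    by exists 1%g, (fdelta i true); split;
      [apply: affine_reflect | apply: affine_odd_reflect].
  exists (tperm i j), ffalse; split; first exact: affine_swap.
  by apply: affine_odd_swap; rewrite neq_ltn ij.
exists (q * p)%g, [ffun k => c (q k) (+) d k]; split=> [x|].
  by rewrite /= mqd wpc affine_comp.
by rewrite affine_odd_comp odd_m odd_w.
Qed.

Lemma moves_fun_cat (w w' : seq (cube_move n)) :
  moves_fun (w ++ w') =1 moves_fun w \o moves_fun w'.
Proof. by move=> x; elim: w => //= m w ->. Qed.

Lemma affine_moves p c :
  exists w : seq (cube_move n), affine p c =1 moves_fun w.
Proof.
have [wp wpE] : exists w : seq (cube_move n), affine p ffalse =1 moves_fun w.
  have [ts -> tsN] := prod_tpermP p.
  elim: ts tsN => [_|[i j] ts IH /= /andP[ij /IH[w wE]]].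
    by exists nil => x; rewrite big_nil affine_id.
  have [m mE] : exists m : cube_move n, move_fun m =1 cube_swap i j.
    have [lt_ij|lt_ji|/val_inj/eqP] := ltngtP i j; last by rewrite (negbTE ij).
      by exists (Swap lt_ij).
    by exists (Swap lt_ji) => x; rewrite /= /cube_swap tpermC.
  exists (m :: w) => x; rewrite /= mE -wE affine_swap affine_comp big_cons.
  by congr affine; apply/ffunP => k; rewrite !ffunE.
have [wc wcE] : exists w : seq (cube_move n), affine 1 c =1 moves_fun w.
  exists [seq Reflect i | i <- enum 'I_n & c i] => x; apply/ffunP => k.
  rewrite ffunE perm1.
  (* Stated for any duplicate-free list, so that no coordinate is reflected twice. *)
  suff H s : uniq s -> moves_fun [seq Reflect i | i <- s & c i] x k =
      x k (+) ((k \in s) && c k).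
    by rewrite H ?enum_uniq ?mem_enum.
  elim: s => [|i s IH] /=; first by rewrite addbF.
  case/andP=> i_s /IH {}IH; rewrite inE; case: ifP => ci.
    rewrite /= cube_reflectE IH; case: eqVneq => [->|_] /=.
      by rewrite (negbTE i_s) ci addbF.
    by rewrite addbF.
  by rewrite IH; case: eqVneq => [->|_] //=; rewrite ci !andbF.
exists (wc ++ wp) => x; rewrite moves_fun_cat /= -wpE -wcE affine_comp.
by rewrite mul1g; congr affine; apply/ffunP => k; rewrite !ffunE.
Qed.

(** At each vertex, [f] induces an injective map of edge directions. Once this map is known to be
    the same at all vertices, it determines [f] together with the image of the zero vertex. *)
Lemma cube_automorphism (f : bits n -> bits n) :
  injective f -> (forall x y, cube_adj x y -> cube_adj (f x) (f y)) ->
  exists p c, f =1 affine p c.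
Proof.
move=> f_inj f_adj.
have fr x i : exists j, f (cube_reflect i x) = cube_reflect j (f x).
  exact/cube_adjP/f_adj/cube_adj_reflect.
pose dir x i := projT1 (cid (fr x i)).
have dirE x i : f (cube_reflect i x) = cube_reflect (dir x i) (f x).
  exact: projT2 (cid (fr x i)).
have dir_inj x : injective (dir x).
  move=> i j ij; apply: (@cube_reflect_dir_inj x); apply: f_inj.
  by rewrite !dirE ij.
(* A square is mapped to a square, and opposite sides of a square are
   parallel. *)
have dir_reflect j x i : dir (cube_reflect j x) i = dir x i.
  have [->|ij] := eqVneq i j.
    apply: (@cube_reflect_dir_inj (f (cube_reflect j x))).
    by rewrite -dirE cube_reflectK dirE cube_reflectK.
  have := congr1 f (cube_reflectC i j x).
  rewrite !dirE => /ffunP/(_ (dir x i)); rewrite !cube_reflectE eqxx.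
  have -> : (dir x i == dir x j) = false.
    by apply/negbTE; apply: contraNneq ij => /dir_inj ->.
  (* Otherwise a walk along [i] and then [j] would be mapped to a walk returning to [f x], against
     injectivity. *)
  have -> : (dir x i == dir (cube_reflect i x) j) = false.
    apply/negbTE; apply/eqP => E; have := dirE (cube_reflect i x) j.
    rewrite -E (dirE x) cube_reflectK => /f_inj/ffunP/(_ i).
    by rewrite !cube_reflectE eqxx (negbTE ij); case: (x i).
  rewrite !addbF; case: eqVneq => [-> //|_].
  by case: (f x _).
pose x0 := ffalse.
have dir0 x i : dir x i = dir x0 i.
  move: x i; apply: (@cube_reflect_ind _ x0) => // j x IH i.
  by rewrite dir_reflect.
(* The inverse is taken because [affine] reads coordinate [k] of the image from coordinate [p k] of
   the argument. *)
pose q := perm (dir_inj x0); pose p := (q^-1)%g.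
exists p, (f x0); apply: (@cube_reflect_ind _ x0) => [|i x IH].
  by apply/ffunP => k; rewrite !ffunE.
apply/ffunP => k.
rewrite dirE dir0 cube_reflectE IH !ffunE -/(cube_reflect _ _) addbAC.
have -> : (k == dir x0 i) = (p k == i).
  by rewrite -[RHS](inj_eq (@perm_inj _ q)) /p permKV permE.
by case: (p k == i); rewrite ?addbT ?addbF ?addNb.
Qed.
End Reflections.

(** * Singular cubes with a given image *)

Section CubeImages.
Variables (n : nat) (G : graph).
Implicit Types (s t : singular_cube n G) (p : 'S_n) (c x y : bits n).

Lemma singular_cube_edge s x y :
  cube_adj x y -> s x = s y \/ adj (s x) (s y).
Proof. by case: s => s /[dup] /asboolP s_map Ps /s_map. Qed.

Lemma affine_invertible p c : exists q d,
  cancel (affine q d) (affine p c) /\ cancel (affine p c) (affine q d).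
Proof.
exists (p^-1)%g, [ffun k => c ((p^-1)%g k)]; split=> x; apply/ffunP => k.
  by rewrite !ffunE permK addbK.
by rewrite !ffunE permKV addbK.
Qed.

Lemma affine_adj p c x y :
  cube_adj x y -> cube_adj (affine p c x) (affine p c y).
Proof.
move=> /cube_adjP[i ->]; apply/cube_adjP; exists ((p^-1)%g i).
apply/ffunP => k; rewrite cube_reflectE !ffunE -/(cube_reflect _ _) addbAC.
have -> : (k == (p^-1)%g i) = (p k == i).
  by rewrite -[LHS](inj_eq (@perm_inj _ p)) permKV.
by case: (p k == i); rewrite ?addbT ?addbF ?addNb.
Qed.

Lemma subgraph_eq (D E : subgraph G) :
  (forall v, sub_vertices D v <-> sub_vertices E v) ->
  (forall e, sub_edges D e <-> sub_edges E e) -> D = E.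
Proof.
case: D E => [[DV DE] PD] [[EV EE] PE]; rewrite /sub_vertices /sub_edges /=.
move=> V E; apply: val_inj; congr pair.
  by apply/funext => x; apply/propext.
by apply/funext => x; apply/propext.
Qed.

Lemma image_graph_affine s t p c :
  s =1 t \o affine p c -> image_graph s = image_graph t.
Proof.
have [q [d [qK pK]]] := affine_invertible p c => st.
have ts x : t x = s (affine q d x) by rewrite st /= qK.
apply: subgraph_eq => [x|[u v]]; rewrite /sub_vertices /sub_edges /=.
  split=> -[y _ <-]; last by exists (affine q d y).
  by exists (affine p c y).
split=> -[uv [x [y [xy xu yv]]]]; split=> //.
  exists (affine p c x), (affine p c y).
  by rewrite affine_adj // -xu -yv !st.
exists (affine q d x), (affine q d y).
by rewrite affine_adj // -xu -yv !ts.
Qed.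

(** The change of parametrisation preserves adjacency: an edge of the common image comes from a cube
    edge under [t], and injectivity of [t] identifies its ends. *)
Lemma same_image_affine s t :
  injective s -> injective t -> image_graph s = image_graph t ->
  exists p c, s =1 t \o affine p c.
Proof.
move=> s_inj t_inj st.
have range_t x : exists y, t y = s x.
  have : sub_vertices (image_graph s) (s x) by exists x.
  by rewrite st => -[y _ <-]; exists y.
pose f x : bits n := projT1 (cid (range_t x)).
have fE x : t (f x) = s x := projT2 (cid (range_t x)).
have f_inj : injective f by move=> x y xy; apply: s_inj; rewrite -!fE xy.
have f_adj x y : cube_adj x y -> cube_adj (f x) (f y).
  move=> xy; have adj_xy : adj (s x) (s y).
    have [/s_inj E|//] := singular_cube_edge s xy.
    by move: xy; rewrite E cube_adj_irrefl.
  have : sub_edges (image_graph s) (s x, s y) by split=> //; exists x, y.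
  by rewrite st -!fE => -[_ [u [v [uv /t_inj <- /t_inj <-]]]].
have [p [c fpc]] := cube_automorphism f_inj f_adj.
by exists p, c => x; rewrite -fE fpc.
Qed.

Lemma image_is_cube s : injective s -> is_cube n (image_graph s).
Proof.
move=> s_inj; exists s; split=> // x y; split.
  move=> xy; split; last by exists x, y.
  have [/s_inj E|//] := singular_cube_edge s xy.
  by move: xy; rewrite E /= cube_adj_irrefl.
by case=> _ [u [v [uv /s_inj <- /s_inj <-]]].
Qed.

(** A counting argument: choosing preimages under [s] gives an injective self-map of the finite
    vertex set of the cube, hence a bijection. *)
Lemma cube_image_inj s : is_cube n (image_graph s) -> injective s.
Proof.
case=> f [f_inj fV _].
have range_s x : exists y, s y = f x.
  have : range f (f x) by exists x.
  by rewrite -fV => -[y _ <-]; exists y.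
pose g x : bits n := projT1 (cid (range_s x)).
have gE x : s (g x) = f x := projT2 (cid (range_s x)).
have g_inj : injective g by move=> x y xy; apply: f_inj; rewrite -!gE xy.
have [h hK gK] := injF_bij g_inj.
by move=> x y; rewrite -(gK x) -(gK y) !gE => /f_inj ->.
Qed.

Lemma cell_cube (D : CW_cell G n) :
  exists s, image_graph s = val D :> subgraph G.
Proof.
case: D => D /[dup] /asboolP[f [f_inj fV fE]] PD /=.
have f_map : @graph_map (cube n) G (finfun f).
  move=> x y xy; right; rewrite !ffunE; have /fE := xy.
  by case: D {PD} fV fE => D /[dup] /asboolP[DE _] PD _ _ /DE[].
exists (exist _ (finfun f) (asboolT f_map)).
apply: subgraph_eq => [x|[u v]].
  rewrite fV /sub_vertices /=; split=> -[y _ <-]; exists y => //;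
    by rewrite /cube_fun /= ffunE.
split=> [[_ [x [y [/= xy <- <-]]]]|uv].
  by rewrite /cube_fun /= !ffunE; apply/fE.
have [adj_uv Du Dv] : [/\ adj u v, sub_vertices D u & sub_vertices D v].
  by case: D {PD fV fE} uv => D /[dup] /asboolP[DE _] PD /DE[].
move: Du Dv; rewrite fV => -[x _ xu] [y _ yv]; split=> //; exists x, y.
by split; rewrite /cube_fun /= ?ffunE //; apply/fE; rewrite xu yv.
Qed.

Definition ref_cube (D : CW_cell G n) : singular_cube n G :=
  projT1 (cid (cell_cube D)).

Lemma image_ref_cube D : image_graph (ref_cube D) = val D.
Proof. exact: projT2 (cid (cell_cube D)). Qed.

Lemma supported_inj s (D : CW_cell G n) : image_graph s = val D -> injective s.
Proof.
by move=> sD; apply: cube_image_inj; rewrite sD; apply/asboolP/(valP D).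
Qed.

Lemma ref_cube_inj D : injective (ref_cube D).
Proof. exact: supported_inj (image_ref_cube D). Qed.

(** The value is also [false] when the image of [s] is not [D]; [cell_coef] tests this case
    separately. *)
Definition orientation (D : CW_cell G n) s : bool :=
  `[< exists p c, s =1 ref_cube D \o affine p c /\ affine_odd p c >].

Lemma orientationE D s p c :
  s =1 ref_cube D \o affine p c -> orientation D s = affine_odd p c.
Proof.
move=> spc; apply/asboolP/idP => [[q [d [sqd]]]|]; last by exists p, c.
have [-> -> //] : p = q /\ c = d.
apply: affine_inj => x; apply: (@ref_cube_inj D).
by have := spc x; rewrite sqd.
Qed.

Lemma orientation_affine D s t p c :
  image_graph t = val D -> s =1 t \o affine p c ->
  orientation D s = affine_odd p c (+) orientation D t.
Proof.
move=> tD st.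
have [q [d tqd]] : exists q d, t =1 ref_cube D \o affine q d.
  apply: same_image_affine; first exact: supported_inj tD.
    exact: ref_cube_inj.
  by rewrite image_ref_cube.
rewrite (orientationE tqd) addbC -affine_odd_comp; apply: orientationE => x.
by rewrite st /= tqd /= affine_comp.
Qed.

Definition cell_coef (D : CW_cell G n) s : int :=
  if image_graph s == val D then (-1) ^+ orientation D s else 0.

Lemma cell_coef_affine D s t p c : s =1 t \o affine p c ->
  cell_coef D s = (-1) ^+ affine_odd p c * cell_coef D t.
Proof.
move=> st; rewrite /cell_coef (image_graph_affine st).
case: eqP => [tD|_]; last by rewrite mulr0.
by rewrite (orientation_affine tD st) signr_addb.
Qed.

Lemma cell_coef_ninj D s : ~ injective s -> cell_coef D s = 0.
Proof.
by rewrite /cell_coef; case: eqP => // /supported_inj.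
Qed.

(** [insub] fails exactly when the image is not an n-cube, that is, when [s] is not injective. *)
Definition oriented_cell s : {freeg (CW_cell G n) / int} :=
  if insub (image_graph s) is Some D then fgen D *~ (-1) ^+ orientation D s
  else 0.

Lemma coeff_oriented_cell D s : coeff D (oriented_cell s) = cell_coef D s.
Proof.
rewrite /oriented_cell /cell_coef; case: insubP => [E _ sE|sN].
  rewrite -sE raddfMz /= /fgen coeffU mul1r; case: (E =P D) => [->|ED].
    by rewrite eqxx intz.
  by case: eqP => [/(@val_inj _ _ (CW_cell G n)) //|_]; rewrite mul0rz.
rewrite coeff0; case: eqP => // sD; case/negP: sN.
by rewrite sD; case: D {sD}.
Qed.

Lemma oriented_cell_eq s (a : {freeg (CW_cell G n) / int}) :
  (forall D, coeff D a = cell_coef D s) -> oriented_cell s = a.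
Proof.
by move=> aE; apply/eqP/freeg_eqP => D; rewrite coeff_oriented_cell aE.
Qed.
End CubeImages.

(** * Facets of a noninjective cube *)

Section SmallDisplacement.
Variable n : nat.
Implicit Types (p : 'S_n) (c x : bits n).

(** If [p] is the identity, at most one sign is set. If [p k = l != k], vertices displaced at [k]
    must be fixed elsewhere; this forces [p] to swap [k] and [l], with exactly one of the signs
    [c k], [c l] set and no other: a quarter turn, which is even. *)
Lemma affine_small_displacement p c :
  (forall x, affine p c x = x \/ cube_adj (affine p c x) x) ->
  affine_odd p c = false \/ exists k, affine p c =1 cube_reflect k.
Proof.
move=> small.
have close x k l : affine p c x k != x k -> affine p c x l != x l -> k = l.
  case: (small x) => [->|]; first by rewrite eqxx.
  case/cube_adjP=> i xE.
  rewrite [in X in _ != X -> _]xE [in X in _ -> _ != X -> _]xE !cube_reflectE.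
  case: (eqVneq k i) => [->|_]; last by rewrite addbF eqxx.
  by case: (eqVneq l i) => [->|_] //; rewrite addbF eqxx.
have [p1|] := eqVneq p 1%g.
  subst p; have [[k ck]|c0] := pselect (exists k, c k).
    right; exists k => x; apply/ffunP => l; rewrite affine_reflect !ffunE perm1.
    rewrite andbT; congr (_ (+) _).
    have [->|lk] := eqVneq l k; first by rewrite ck.
    apply: contraNF lk => cl; apply/eqP; apply: (close x);
      by rewrite !ffunE perm1 ?cl ?ck; case: (x _).
  left; suff -> : c = ffalse n by rewrite affine_odd_id.
  by apply/ffunP => k; rewrite ffunE; apply/negP => ck; apply: c0; exists k.
move=> p_neq1; left.
have [k pk] : exists k, p k != k.
  apply/existsP; apply: contraNT p_neq1 => /existsPn pE.
  by apply/eqP/permP => k; rewrite perm1; apply/eqP/negPn/pE.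
have pl : p (p k) != p k by rewrite (inj_eq perm_inj).
set l := p k in pk pl.
have kl : (k == l) = false by rewrite eq_sym; apply/negbTE.
(* [x l = 0] and [x k = 1 + c k] displace [x] at [k]; a second displaced
   coordinate cannot exist, and the remaining coordinates of [x] are free. *)
have test m b b' : m != k -> m != l -> p m != l -> p m != k ->
    (p m == m -> b = b') -> b (+) c m != b' -> False.
  move=> mk ml pml pmk bb' mb.
  pose x : bits n := [ffun j => if j == l then false else if j == k then ~~ c k
                        else if j == m then b' else b].
  suff : k = m by move/eqP; rewrite eq_sym (negbTE mk).
  apply: (close x);
    rewrite !ffunE -/l eqxx ?kl ?eqxx ?(negbTE mk) ?(negbTE ml) ?eqxx.
    by case: (c k).
  rewrite (negbTE pml) (negbTE pmk); case: (eqVneq (p m) m) => [pm|//].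
  by move: mb; rewrite bb' ?pm.
(* Otherwise coordinate [p l] of [x] can be chosen so as to displace [l] besides [k]. *)
have plk : p l = k.
  apply/eqP/idPn => plk.
  pose x : bits n := [ffun j => if j == l then false else if j == k then ~~ c k
                        else ~~ c l].
  suff : k = l by move/eqP; rewrite kl.
  apply: (close x); rewrite !ffunE -/l eqxx ?kl ?eqxx; first by case: (c k).
  by rewrite (negbTE pl) (negbTE plk); case: (c l).
have ckl : c l = ~~ c k.
  apply/eqP/idPn => ckl.
  pose x : bits n := [ffun j => if j == l then false else ~~ c k].
  suff : k = l by move/eqP; rewrite kl.
  apply: (close x); rewrite !ffunE -/l eqxx ?plk ?kl //; first by case: (c k).
  by move: ckl; case: (c l); case: (c k).
have pm m : m != k -> m != l -> p m = m /\ c m = false.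
  move=> mk ml.
  have pml : p m != l by rewrite (inj_eq perm_inj).
  have pmk : p m != k by rewrite -plk (inj_eq perm_inj).
  have pmm : p m = m.
    apply/eqP/idPn => pmm; apply: (@test m false (~~ c m)) => //.
      by rewrite (negbTE pmm).
    by case: (c m).
  split=> //; apply/negP => cm; apply: (@test m false false) => //.
  by rewrite cm.
have pE : p = tperm k l.
  apply/permP => m; case: tpermP => [->|->|/eqP mk /eqP ml] //.
  by have [] := pm m mk ml.
(* The odd transposition and the single sign cancel. *)
rewrite /affine_odd pE odd_tperm kl (bigD1 k) //= (bigD1 l) 1?eq_sym ?kl //=.
rewrite big1 ?addbF ?ckl; first by case: (c k).
by move=> m /andP[mk ml]; have [] := pm m mk ml.
Qed.
End SmallDisplacement.

Section FacetInsertion.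
Variable n : nat.

Definition cube_del (i : 'I_n) (x : bits n) : bits n.-1 :=
  [ffun k => x (fintype.lift i k)].

Lemma cube_insK i b (y : bits n.-1) : cube_del i (cube_ins i b y) = y.
Proof. by apply/ffunP => k; rewrite !ffunE liftK. Qed.

Lemma cube_ins_at i b (y : bits n.-1) : cube_ins i b y i = b.
Proof. by rewrite ffunE unlift_none. Qed.

Lemma cube_ins_lift i b (y : bits n.-1) k :
  cube_ins i b y (fintype.lift i k) = y k.
Proof. by rewrite ffunE liftK. Qed.

Lemma cube_delK (i : 'I_n) b (x : bits n) :
  x i = b -> cube_ins i b (cube_del i x) = x.
Proof.
move=> xi; apply/(@ffunP _ (fun=> bool)) => k; rewrite ffunE.
by case: unliftP => [j ->|->]; rewrite ?ffunE.
Qed.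

Lemma cube_ins_inj i b : injective (@cube_ins n i b).
Proof. exact: can_inj (@cube_insK i b). Qed.

Lemma cube_ins_eq i b (x : bits n) (y : bits n.-1) :
  x i = b -> (forall k, x (fintype.lift i k) = y k) -> cube_ins i b y = x.
Proof.
move=> xi xy; rewrite -[RHS](cube_delK xi); congr cube_ins.
by apply/ffunP => k; rewrite ffunE xy.
Qed.

Lemma cube_reflect_ins i b (y : bits n.-1) :
  cube_reflect i (cube_ins i b y) = cube_ins i (~~ b) y.
Proof.
apply/esym/cube_ins_eq => [|k]; rewrite cube_reflectE.
  by rewrite cube_ins_at eqxx addbT.
by rewrite cube_ins_lift eq_sym (negbTE (neq_lift i k)) addbF.
Qed.

Lemma cube_reflect_ins_lift i k b (y : bits n.-1) :
  cube_reflect (fintype.lift i k) (cube_ins i b y) =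
  cube_ins i b (cube_reflect k y).
Proof.
apply/esym/cube_ins_eq => [|l]; rewrite cube_reflectE.
  by rewrite cube_ins_at (negbTE (neq_lift i k)) addbF.
by rewrite cube_ins_lift cube_reflectE (inj_eq lift_inj).
Qed.

Lemma faceE G i b (s : singular_cube n G) y : face i b s y = s (cube_ins i b y).
Proof. by rewrite /cube_fun /= ffunE. Qed.
End FacetInsertion.

(** [lift_perm i j 1] sends [i] to [j] and matches the other coordinates in increasing order, so it
    identifies facets in direction [j] with facets in direction [i]. *)
Lemma affine_facet n (i j : 'I_n.+1) b d (y : bits n) :
  affine (lift_perm i j 1) (fdelta i d) (cube_ins j b y) =
  cube_ins i (b (+) d) y.
Proof.
apply/esym/cube_ins_eq => [|k]; rewrite ffunE [fdelta _ _ _]ffunE.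
  by rewrite lift_perm_id cube_ins_at eqxx.
rewrite lift_perm_lift perm1 cube_ins_lift.
by rewrite eq_sym (negbTE (neq_lift i k)) addbF.
Qed.

(** Here and below, [j'] numbers the direction [j] inside a facet of direction [i], and [i'] numbers
    [i] inside a facet of direction [j]. *)
Lemma cube_ins_exchange n (i j : 'I_n.+2) (i' j' : 'I_n.+1) a b (y : bits n) :
  j = fintype.lift i j' -> i = fintype.lift j i' ->
  cube_ins i a (cube_ins j' b y) = cube_ins j b (cube_ins i' a y).
Proof.
move=> ij ji; rewrite (@cube_ins_swap _ (i, j')) /face_swap /= -ij.
by rewrite ji liftK.
Qed.

Lemma affine_odd_facet n (i j : 'I_n.+1) d :
  affine_odd (lift_perm i j 1) (fdelta i d) = odd i (+) odd j (+) d.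
Proof. by rewrite /affine_odd odd_lift_perm odd_perm1 addbF big_fdelta. Qed.

(** * Cubes with several facets on one cell *)

Section Folding.
Variables (n : nat) (G : graph) (s : singular_cube n.+1 G) (D : CW_cell G n).

Definition supports i b : Prop :=
  image_graph (face i b s : singular_cube n G) = val D.

(** The contribution of the facet to the coefficient of [D] in the boundary, up to a global sign:
    with [i] counted from 0, the incidence number is the opposite of [(-1) ^+ (odd i (+) b)]. *)
Definition facet_coef i b : int :=
  cell_coef D (face i b s : singular_cube n G) * (-1) ^+ (odd i (+) b).

Lemma facet_coef0 i b : ~ supports i b -> facet_coef i b = 0.
Proof. by rewrite /facet_coef /cell_coef; case: eqP => //; rewrite mul0r. Qed.

Lemma supports_inj i b (x y : bits n.+1) : supports i b -> x i = b -> y i = b ->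
  s x = s y -> x = y.
Proof.
move=> /supported_inj s_inj xi yi; rewrite -(cube_delK xi) -(cube_delK yi).
by rewrite -!faceE => /s_inj ->.
Qed.
End Folding.

(* The two facets agree on their intersection, which determines how [s] folds
   one onto the other. *)
Lemma adjacent_facets n G (s : singular_cube n.+2 G) (D : CW_cell G n.+1)
    (i j : 'I_n.+2) (i' j' : 'I_n.+1) a b :
  j = fintype.lift i j' -> i = fintype.lift j i' ->
  supports s D i a -> supports s D j b ->
  face i a s =1 face j b s \o affine (lift_perm i' j' 1) (fdelta i' (a (+) b)).
Proof.
move=> ij ji ia jb.
have [p [c ijE]] : exists p c,
    (face i a s : singular_cube n.+1 G) =1 face j b s \o affine p c.
  apply: same_image_affine (supported_inj ia) (supported_inj jb) _.
  by rewrite /supports in ia jb; rewrite ia jb.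
suff [<- <-] : p = lift_perm i' j' 1 /\ c = fdelta i' (a (+) b) by [].
apply: (@affine_inj_facet _ j' b) => x xj; apply: (supported_inj jb).
have := ijE x; rewrite /= => <-; rewrite -[in RHS](cube_delK xj) affine_facet.
rewrite !(@faceE n.+2) addbCA addbb addbF -{1}(cube_delK xj).
by rewrite (cube_ins_exchange _ _ _ ij ji).
Qed.

Section AdjacentFacets.
Variables (n : nat) (G : graph) (s : singular_cube n.+2 G) (D : CW_cell G n.+1).
Variables (i j : 'I_n.+2) (i' j' : 'I_n.+1).
Hypotheses (ij : j = fintype.lift i j') (ji : i = fintype.lift j i').

(** Deleting one of the two directions lowers the index of the other only if that one is the
    larger. *)
Lemma facet_directions_parity : ~~ odd i (+) odd i' = odd j (+) odd j'.
Proof.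
move: ij ji => /(congr1 val)/= + /(congr1 val)/=.
rewrite /bump => ij_val ji_val.
have [[-> ->]|[-> ->]] : (j = j'.+1 :> nat /\ i' = i :> nat) \/
    (j = j' :> nat /\ i = i'.+1 :> nat) by lia.
  by rewrite /= !addNb !addbb.
by rewrite /= negbK !addbb.
Qed.

(** The sign of the fold, of exponent [i' + j' + a + b], is opposite to the ratio of the two
    incidence signs. *)
Lemma adjacent_facets_coef a b : supports s D i a -> supports s D j b ->
  facet_coef s D i a + facet_coef s D j b = 0.
Proof.
move=> ia jb; rewrite /facet_coef.
rewrite (cell_coef_affine D (adjacent_facets ij ji ia jb)) affine_odd_facet.
rewrite mulrAC [X in X + _]mulrC -signr_addb mulrC [X in _ + X]mulrC.
rewrite mulrC [X in _ + X]mulrC -mulrDr.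
have -> : odd i' (+) odd j' (+) (a (+) b) (+) (odd i (+) a) = ~~ (odd j (+) b).
  move: facet_directions_parity.
  by case: (odd i); case: (odd j); case: (odd i'); case: (odd j');
    case: a {ia}; case: b {jb}.
by rewrite signrN addNr mulr0.
Qed.

(** In every square of directions [i], [j], the two corners lying in just one of the two facets are
    identified by the fold. *)
Lemma adjacent_facets_fold a b (x : bits n.+2) :
  supports s D i a -> supports s D j b -> x i (+) x j = ~~ (a (+) b) ->
  s (cube_reflect i (cube_reflect j x)) = s x.
Proof.
move=> ia jb.
have fold (z : bits n.+2) : z i = a -> z j = ~~ b ->
    s (cube_reflect i (cube_reflect j z)) = s z.
  move=> zi zj; have z'j' : cube_del i z j' = ~~ b by rewrite ffunE -ij.
  rewrite -(cube_delK zi) -(cube_delK z'j').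
  rewrite [X in cube_reflect _ (cube_reflect X _)]ij cube_reflect_ins_lift.
  rewrite !cube_reflect_ins.
  rewrite negbK (cube_ins_exchange _ _ _ ij ji).
  set y := cube_del j' _.
  have := adjacent_facets ij ji ia jb (cube_ins j' (~~ b) y).
  rewrite /= affine_facet !(@faceE n.+2) => ->.
  by rewrite addbCA addNb addbb addbT.
move=> xij; have [xi|xi] := eqVneq (x i) a.
  by apply: fold => //; move: xij; rewrite xi -addbN => /addbI.
have ij_neq : (i == j) = false by rewrite ij (negbTE (neq_lift i j')).
have ji_neq : (j == i) = false by rewrite eq_sym.
rewrite -fold.
- by rewrite (cube_reflectC j i) !cube_reflectK.
- rewrite !cube_reflectE eqxx ij_neq addbF addbT.
  by move: xi; case: (x i); case: a {ia fold xij}.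
- rewrite !cube_reflectE eqxx ji_neq addbF addbT.
  by move: xi xij; case: (x i); case: (x j); case: a {ia fold}; case: b {jb}.
Qed.

(** A facet in a third direction contains a pair of identified corners, so [s] is not injective on
    it. *)
Lemma adjacent_facets_third a b k c : k != i -> k != j ->
  supports s D i a -> supports s D j b -> ~ supports s D k c.
Proof.
move=> ki kj ia jb kc.
have ij_neq : (i == j) = false by rewrite ij (negbTE (neq_lift i j')).
pose x : bits n.+2 :=
  [ffun l => if l == i then a else if l == j then ~~ b else c].
have xi : x i = a by rewrite ffunE eqxx.
have xj : x j = ~~ b by rewrite ffunE eqxx eq_sym ij_neq.
have xk : x k = c by rewrite ffunE (negbTE ki) (negbTE kj).
have /ffunP/(_ i) : cube_reflect i (cube_reflect j x) = x.
  apply: (supports_inj kc) => //.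
    by rewrite !cube_reflectE (negbTE ki) (negbTE kj) xk !addbF.
  by apply: adjacent_facets_fold ia jb _; rewrite xi xj addbN.
by rewrite !cube_reflectE eqxx ij_neq; case: (x i).
Qed.

(** The folds for [a] and for [~~ a] identify both pairs of opposite corners of each square. The two
    facets in direction [j] then differ by a reflection in direction [i]. *)
Lemma adjacent_facets_opposite a b : supports s D i a -> supports s D j b ->
  supports s D i (~~ a) -> supports s D j (~~ b).
Proof.
move=> ia jb ia'; rewrite /supports -[in RHS]jb.
apply: (image_graph_affine (p := 1%g) (c := fdelta i' true)) => y.
rewrite /= -(affine_reflect i') !(@faceE n.+2) -cube_reflect_ins_lift -ji.
rewrite -[b in RHS]negbK -(cube_reflect_ins j (~~ b)).
set x := cube_ins _ _ _.
have [xij|xij] := eqVneq (x i (+) x j) (~~ (a (+) b)).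
  by rewrite (adjacent_facets_fold ia jb xij).
rewrite (adjacent_facets_fold ia' jb) //.
by move: xij; rewrite addNb negbK; case: (_ (+) _); case: (_ (+) _).
Qed.
End AdjacentFacets.

(** The facets [(i, a)] and [(j, b)] cancel; the facets opposite to them are both supported by [D],
    and cancel too, or neither is. *)
Lemma supports_two_directions n G (s : singular_cube n.+1 G) (D : CW_cell G n)
    (i j : 'I_n.+1) a b :
  i != j -> supports s D i a -> supports s D j b ->
  \sum_k (facet_coef s D k false + facet_coef s D k true) = 0.
Proof.
case: n s D i j => [|n] s D i j; first by rewrite !ord1 eqxx.
move=> ij_neq ia jb.
have /unlift_some[j' ij _] := ij_neq.
have /unlift_some[i' ji _] : j != i by rewrite eq_sym.
rewrite (bigD1 i) // (bigD1 j) 1?eq_sym //=.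
rewrite big1 => [|k /andP[ki kj]]; last first.
  have k0 := adjacent_facets_third ij ji ki kj ia jb.
  by rewrite !facet_coef0.
rewrite addr0.
suff H : facet_coef s D i (~~ a) + facet_coef s D j (~~ b) = 0.
  have := adjacent_facets_coef ij ji ia jb.
  have split_sum k c : facet_coef s D k false + facet_coef s D k true =
      facet_coef s D k c + facet_coef s D k (~~ c).
    by case: c => //; rewrite addrC.
  by rewrite (split_sum i a) (split_sum j b) addrACA H => ->.
have [ia'|ia'] := pselect (supports s D i (~~ a)).
  apply: (adjacent_facets_coef ij ji) => //.
  exact (adjacent_facets_opposite ij ji ia jb ia').
rewrite !facet_coef0 // => jb'; apply: ia'.
exact (adjacent_facets_opposite ji ij jb ia jb').
Qed.

(** In the facet [j = 1], the half [i = 0] has the same values as the part [j = 0] of the facet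
    [i = 1]. So [i] takes over the role of [j], and both facets have the same image. *)
Lemma reflected_facets n G (s : singular_cube n.+2 G) (D : CW_cell G n.+1)
    (i j : 'I_n.+2) (i' j' : 'I_n.+1) :
  j = fintype.lift i j' -> i = fintype.lift j i' ->
  (forall x, face i false s x = face i true s (cube_reflect j' x)) ->
  supports s D i true -> supports s D j true.
Proof.
move=> ij ji i01; rewrite /supports => <-.
apply: (image_graph_affine (p := lift_perm j' i' 1)
  (c := fdelta j' false)) => z.
rewrite -(cube_delK (erefl (z i'))) /= affine_facet addbF.
rewrite [LHS](@faceE n.+2) (cube_ins_exchange _ _ _ ji ij) -(@faceE n.+2).
case: (z i') => //.
by rewrite i01 cube_reflect_ins.
Qed.

Lemma opposite_facets n G (s : singular_cube n.+1 G) (D : CW_cell G n)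
    (i : 'I_n.+1) :
  induced (val D) -> supports s D i false -> supports s D i true ->
  facet_coef s D i false + facet_coef s D i true = 0 \/
  exists2 j, i != j & supports s D j true.
Proof.
move=> D_ind i0 i1.
have [p [c i01]] : exists p c,
    (face i false s : singular_cube n G) =1 face i true s \o affine p c.
  apply: same_image_affine (supported_inj i0) (supported_inj i1) _.
  by rewrite /supports in i0 i1; rewrite i0 i1.
(* The edge of direction [i] over [x] joins the two facets. Its image is a vertex or an edge of [G]
   between vertices of [D], hence an edge of [D], as [D] is induced. *)
have small x : affine p c x = x \/ cube_adj (affine p c x) x.
  have inj1 := supported_inj i1.
  have := singular_cube_edge s (cube_adj_reflect i (cube_ins i false x)).
  rewrite cube_reflect_ins -!(@faceE n.+1) i01 /= => -[/inj1|edge].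
    by left.
  have : sub_edges (val D) (face i true s (affine p c x), face i true s x).
    by apply: D_ind => //; rewrite -i1; [exists (affine p c x) | exists x].
  rewrite -i1 => -[_ [u [v [uv]]]] /= /inj1 <- /inj1 <-.
  by right.
have [even_pc|[k pck]] := affine_small_displacement small.
  left; rewrite /facet_coef (cell_coef_affine D i01) even_pc mul1r -mulrDr.
  by rewrite addbF addbT signrN subrr mulr0.
right; exists (fintype.lift i k); first exact: neq_lift.
case: n s D i {D_ind} i0 i1 p c i01 small k pck =>
  [|n] s D i i0 i1 p c i01 small k pck; first by case: k {pck}.
have /unlift_some[i' ji _] : fintype.lift i k != i by rewrite eq_sym neq_lift.
apply: reflected_facets i1 => // [|x]; first exact: ji.
by rewrite i01 /= pck.
Qed.

Lemma folded_boundary n G (s : singular_cube n.+1 G) (D : CW_cell G n) :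
  induced (val D) -> quasimonophobic_cube n (val D) -> ~ injective s ->
  \sum_k (facet_coef s D k false + facet_coef s D k true) = 0.
Proof.
move=> D_ind D_quasi s_ninj.
have [[i [j [a [b [ij ia jb]]]]]|one_dir] :=
    pselect (exists i j a b, [/\ i != j, supports s D i a & supports s D j b]).
  exact: supports_two_directions ij ia jb.
have [[i [a ia]]|none] := pselect (exists i a, supports s D i a); last first.
  apply: big1 => k _; rewrite !facet_coef0 // => ks;
    by apply: none; eexists; eexists; exact: ks.
have [j [c [jc_neq jc]]] := D_quasi s i a s_ninj ia.
have ji : j = i.
  by apply/eqP/negPn/negP => ji; apply: one_dir; exists j, i, c, a.
(* The additional facet has the same direction, so it is the opposite one. *)
subst j; have ca : c = ~~ a.
  by move: jc_neq; rewrite xpair_eqE eqxx; case: a {ia}; case: c {jc}.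
subst c; rewrite (bigD1 i) //= big1 ?addr0 => [|k ki]; last first.
  have k0 c : ~ supports s D k c.
    by move=> kc; apply: one_dir; exists k, i, c, a.
  by rewrite !facet_coef0.
have [i0 i1] : supports s D i false /\ supports s D i true.
  by case: a ia jc {jc_neq}.
have [//|[j ij j1]] := opposite_facets D_ind i0 i1.
by case: one_dir; exists i, j, true, true.
Qed.

(** * Top-degree chains *)

Section QuotientLift.
Variables (V W : zmodType) (P : zmodClosed V) (f : {additive V -> W}).
Hypothesis fP : forall x, x \in P -> f x = 0.

Definition quot_lift_fun (x : quotient P) : W := f (repr (x : Quotient.quot P)).

Lemma quot_liftE x : quot_lift_fun (proj P x) = f x.
Proof.
apply/eqP; rewrite -subr_eq0 -raddfB fP //.
by rewrite -proj_eq0 raddfB /= /proj_fun reprK subrr.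
Qed.

Lemma quot_lift_is_zmod_morphism : zmod_morphism quot_lift_fun.
Proof.
move=> x y; have [u ->] := proj_surj x; have [v ->] := proj_surj y.
by rewrite -raddfB !quot_liftE raddfB.
Qed.
HB.instance Definition _ := GRing.isZmodMorphism.Build (quotient P) W
  quot_lift_fun quot_lift_is_zmod_morphism.

Definition quot_lift : {additive quotient P -> W} := quot_lift_fun.
End QuotientLift.

Lemma additive_bijective (V W : zmodType) (f : {additive V -> W}) :
  (forall x, f x = 0 -> x = 0) -> (forall y, exists x, f x = y) -> bijective f.
Proof.
move=> f_ker f_surj.
have f_inj : injective f.
  move=> x y xy; apply/eqP; rewrite -subr_eq0; apply/eqP/f_ker.
  by rewrite raddfB xy subrr.
have gK : cancel (fun y => projT1 (cid (f_surj y))) f.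
  by move=> y; apply: projT2 (cid (f_surj y)).
by exists (fun y => projT1 (cid (f_surj y))) => // x; apply: f_inj; rewrite gK.
Qed.

Lemma degree_inj n G (s : singular_cube n G) : injective s -> degree s = n.
Proof.
move=> s_inj; apply/eqP; rewrite eqn_leq degree_le.
pose p : {set 'I_n} * bits n := ([set: 'I_n], ffalse n).
have pn : #|p.1| = n by rewrite cardsT card_ord.
rewrite -[X in (X <= _)%N]pn.
apply: (@leq_bigmax_cond _ _ (fun q : {set 'I_n} * bits n => #|q.1|) p).
by apply/dinjectiveP => x y _ _ /s_inj.
Qed.

(** Only the whole cube is a face of dimension [n]. In dimension 0 every singular cube is
    injective. *)
Lemma degree_ninj n G (s : singular_cube n G) :
  ~ injective s -> (degree s < n)%N.
Proof.
case: n s => [|n] s s_ninj.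
  by case: s_ninj => x y _; apply/(@ffunP _ (fun=> bool)) => -[].
apply/bigmax_leqP => -[A a] /= /dinjectiveP A_inj.
rewrite -ltnS -[ltnRHS]card_ord ltn_neqAle max_card andbT.
apply/negP => /eqP A_full; have AT : A = [set: 'I_n.+1]%SET.
  by apply/eqP; rewrite eqEcard finset.subsetT cardsT A_full leqnn.
by apply: s_ninj => x y; apply: A_inj; apply/forallP => k; rewrite AT inE.
Qed.

Lemma degenerate_ninj n G (s : singular_cube n G) :
  degenerate s -> ~ injective s.
Proof.
case=> i si s_inj.
have := congr1 (fun t : singular_cube _ G => t (ffalse n.-1)) si.
rewrite !faceE => /s_inj/ffunP/(_ i).
by rewrite !cube_ins_at.
Qed.

Lemma mem_preim_sub (V W : zmodType) (f : {additive V -> W})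
    (P : zmodClosed W) x :
  (x \in preim_sub f P) = (f x \in P).
Proof. by []. Qed.

Section CellMap.
Variables (n : nat) (G : graph).

(** This map descends successively to the quotient by degenerate cubes and to the quotient by degree
    below [n], because all cubes killed there are noninjective. *)
Definition cell_chain_Q :
    {additive Q_chain G n -> cellular_chains (CW_box G) n} :=
  flift (@oriented_cell n G).

Lemma cell_chain_Q_ninj (s : singular_cube n G) :
  ~ injective s -> cell_chain_Q (fgen s) = 0.
Proof.
move=> s_ninj; rewrite fliftE; apply: oriented_cell_eq => D.
by rewrite coeff0 cell_coef_ninj.
Qed.

Lemma cell_chain_Q_degenerate x :
  x \in D_subcomplex G n -> cell_chain_Q x = 0.
Proof.
move=> xD; apply/eqP; move/gen_subP: xD => /(_ (ker_sub cell_chain_Q)); apply.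
move=> _ [s s_deg <-]; apply/eqP/cell_chain_Q_ninj; exact: degenerate_ninj.
Qed.

Definition cell_chain_C :
    {additive C_complex G n -> cellular_chains (CW_box G) n} :=
  quot_lift cell_chain_Q_degenerate.

Lemma cell_chain_CE s : cell_chain_C (cube_class s) = oriented_cell s.
Proof.
rewrite [LHS](quot_liftE cell_chain_Q_degenerate).
exact: (fliftE (@oriented_cell n G)).
Qed.

Lemma cell_chain_C_low x :
  x \in C_subcomplex G (n%:Z - 1) n -> cell_chain_C x = 0.
Proof.
move=> xL; apply/eqP; move/gen_subP: xL => /(_ (ker_sub cell_chain_C)); apply.
move=> _ [s [_ s_low ->]]; apply/eqP.
rewrite cell_chain_CE -(fliftE (@oriented_cell n G)).
by apply: cell_chain_Q_ninj => /degree_inj sn; move: s_low; rewrite sn; lia.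
Qed.

Definition cell_chain_C_sub :
    {additive subgroup (C_subcomplex G n n) -> cellular_chains (CW_box G) n} :=
  cell_chain_C \o incl (C_subcomplex G n n).

Lemma cell_chain_C_sub_low x :
  x \in trace_subcomplex (C_subcomplex G n) (C_subcomplex G (n%:Z - 1)) n ->
  cell_chain_C_sub x = 0.
Proof. exact: cell_chain_C_low. Qed.

Definition cell_chain :
    {additive C_graded G n n -> cellular_chains (CW_box G) n} :=
  quot_lift cell_chain_C_sub_low.

Lemma cell_chainE s : cell_chain (graded_class s) = oriented_cell s.
Proof.
by rewrite [LHS](quot_liftE cell_chain_C_sub_low); apply: cell_chain_CE.
Qed.

Lemma top_degree_full (x : C_complex G n) : x \in C_subcomplex G n n.
Proof.
have [y ->] := proj_surj x.
apply: (@freeg_sub_ind _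
  (preim_sub (proj (D_subcomplex G n)) (C_subcomplex G n n))).
exact: cube_class_top.
Qed.

(** As n-cubes have degree at most [n], every n-chain represents a graded one; this avoids carrying
    membership proofs. *)
Definition top_chain_fun (x : C_complex G n) : C_graded G n n :=
  proj (trace_subcomplex (C_subcomplex G n) (C_subcomplex G (n%:Z - 1)) n)
    (exist _ x (top_degree_full x)).

Lemma top_chain_is_zmod_morphism : zmod_morphism top_chain_fun.
Proof.
by move=> x y; rewrite /top_chain_fun -raddfB; congr (proj _ _); apply: val_inj.
Qed.
HB.instance Definition _ := GRing.isZmodMorphism.Build (C_complex G n)
  (C_graded G n n) top_chain_fun top_chain_is_zmod_morphism.

Definition top_chain : {additive C_complex G n -> C_graded G n n} :=
  top_chain_fun.

Lemma top_chain_projE x (Px : x \in C_subcomplex G n n) :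
  proj (trace_subcomplex (C_subcomplex G n) (C_subcomplex G (n%:Z - 1)) n)
    (exist _ x Px) = top_chain x.
Proof. by congr (proj _ _); apply: val_inj. Qed.

Lemma top_chainE s : top_chain (cube_class s) = graded_class s.
Proof. by rewrite -(top_chain_projE (cube_class_top s)). Qed.

Lemma top_chain_surj x : exists y, top_chain y = x.
Proof.
by have [[y Py] ->] := proj_surj x; exists y; rewrite -(top_chain_projE Py).
Qed.

Lemma graded_class_ninj (s : singular_cube n G) :
  ~ injective s -> graded_class s = 0.
Proof.
move=> /degree_ninj s_low; apply/eqP; rewrite proj_eq0.
by apply: cube_class_degree; lia.
Qed.

Lemma graded_class_ind (P : zmodClosed (C_graded G n n)) :
  (forall s, graded_class s \in P) -> forall x, x \in P.
Proof.
move=> sP x; have [y <-] := top_chain_surj x; have [z ->] := proj_surj y.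
pose f : {additive Q_chain G n -> C_graded G n n} :=
  top_chain \o proj (D_subcomplex G n).
suff : z \in preim_sub f P by rewrite mem_preim_sub.
apply: freeg_sub_ind => s; rewrite mem_preim_sub.
have -> : f (fgen s) = graded_class s by exact: top_chainE.
exact: sP.
Qed.
End CellMap.
Arguments top_chain {n G}.
Arguments cell_chain {n G}.

Section TopBoundary.
Variables (n : nat) (G : graph).

(** On chains of degree at most [n] this computes the graded boundary, as the next two lemmas
    show. *)
Definition top_bd (x : C_complex G n.+1) : C_graded G n n :=
  top_chain (bd (C_complex G) n.+1 x : C_complex G n).

Lemma graded_bdE (y : C_graded G n n.+1) : exists x,
  x \in C_subcomplex G n n.+1 /\ bd (C_graded G n) n.+1 y = top_bd x.
Proof.
have [[x Px] ->] := proj_surj y; exists x; split=> //.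
rewrite [LHS]quot_mapE; last exact: subchain_bd.
exact: top_chain_projE.
Qed.

Lemma top_bd_graded (x : C_complex G n.+1) :
  x \in C_subcomplex G n n.+1 -> exists y, bd (C_graded G n) n.+1 y = top_bd x.
Proof.
pose B := trace_subcomplex (C_subcomplex G n) (C_subcomplex G (n%:Z - 1)).
move=> Px; exists (proj (B n.+1) (exist _ x Px)).
rewrite [LHS]quot_mapE; last exact: subchain_bd.
exact: top_chain_projE.
Qed.

Lemma top_bd_class (s : singular_cube n.+1 G) : top_bd (cube_class s) =
  \sum_(i < n.+1) (graded_class (face i false s : singular_cube n G) -
    graded_class (face i true s : singular_cube n G)) *~ (-1) ^+ i.+1.
Proof.
rewrite /top_bd C_bdE raddf_sum; apply: eq_bigr => i _.
rewrite raddfMz raddfB; congr ((_ - _) *~ _);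
  exact: (top_chainE (face i _ s : singular_cube n G)).
Qed.
End TopBoundary.

(** * The relations are boundaries *)

Lemma sign_mem (V : zmodType) (P : zmodClosed V) x m :
  x *~ (-1) ^+ m \in P -> x \in P.
Proof.
move=> xP; have -> : x = (x *~ (-1) ^+ m) *~ (-1) ^+ m.
  by rewrite -mulrzA -expr2 sqrr_sign mulr1z.
exact: rpredMz.
Qed.

Lemma alternating_sum_single (V : zmodType) m (a b : 'I_m -> V) i :
  (forall l, l != i -> a l = 0) -> (forall l, l != i -> b l = 0) ->
  \sum_l (a l - b l) *~ (-1) ^+ l.+1 = (a i - b i) *~ (-1) ^+ i.+1.
Proof.
move=> a0 b0; rewrite (bigD1 i) //= big1 ?addr0 // => l li.
by rewrite a0 // b0 // subrr mul0rz.
Qed.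

(** The minus sign before [b] makes up for the change of sign from [i] to [i + 1]. *)
Lemma alternating_sum_consecutive (V : zmodType) m (a b : 'I_m -> V)
    (i j : 'I_m) :
  j = i.+1 :> nat -> (forall l, l != i -> a l = 0) ->
  (forall l, l != j -> b l = 0) ->
  \sum_l (a l - b l) *~ (-1) ^+ l.+1 = (a i + b j) *~ (-1) ^+ i.+1.
Proof.
move=> ji a0 b0; have ij_neq : j != i by rewrite -val_eqE /= ji; lia.
rewrite (bigD1 i) // (bigD1 j) //= big1 ?addr0 => [|l /andP[li lj]]; last first.
  by rewrite a0 // b0 // subrr mul0rz.
rewrite (a0 j) // (b0 i) 1?eq_sym // subr0 sub0r ji [(-1) ^+ i.+2]exprS mulN1r.
by rewrite mulrNz mulNrz opprK mulrzDl.
Qed.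

Lemma signed_telescope (V : zmodType) (a b c : V) m :
  a - b *~ (-1) ^+ m + (c + b) *~ (-1) ^+ m = a - c *~ (-1) ^+ m.+1.
Proof.
rewrite exprS mulN1r mulrNz opprK mulrzDl addrCA -addrA.
by rewrite addNr addr0 addrC.
Qed.

Section Fillings.
Variables (n : nat) (G : graph).
Implicit Types (s t : singular_cube n G).

Lemma singular_cube_eq m (s t : singular_cube m G) : s =1 t -> s = t.
Proof. by move=> st; apply: val_inj; apply/ffunP => x; apply: st. Qed.

Lemma singular_cube_comp m t (f : bits m -> bits n) :
  (forall x y, cube_adj x y -> f x = f y \/ cube_adj (f x) (f y)) ->
  exists u : singular_cube m G, u =1 t \o f.
Proof.
move=> f_map; have tf_map : @graph_map (cube m) G [ffun x => t (f x)].
  move=> x y /f_map; rewrite !ffunE => -[->|/singular_cube_edge//].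
  by left.
exists (exist _ [ffun x => t (f x)] (asboolT tf_map)) => x.
by rewrite /cube_fun /= ffunE.
Qed.

Lemma face_ninj m (u : singular_cube m G) l b (z z' : bits m) :
  z l = b -> z' l = b -> z != z' -> u z = u z' -> ~ injective (face l b u).
Proof.
move=> zl z'l zz' uzz' u_inj; case/eqP: zz'.
rewrite -(cube_delK zl) -(cube_delK z'l); congr cube_ins; apply: u_inj.
by rewrite !faceE !cube_delK.
Qed.

Lemma cube_adj_off k (x y : bits n) :
  (forall m, m != k -> x m = y m) -> x = y \/ cube_adj x y.
Proof.
move=> xy; have [xyk|xyk] := eqVneq (x k) (y k).
  left; apply/(@ffunP _ (fun=> bool)) => m.
  by have [->|/xy] := eqVneq m k.
right; apply/cube_adjP; exists k; apply/(@ffunP _ (fun=> bool)) => m.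
rewrite cube_reflectE; have [->|/xy ->] := eqVneq m k; last by rewrite addbF.
by move: xyk; case: (x k); case: (y k).
Qed.

Definition image_bd : zmodClosed (C_graded G n n) :=
  im_sub (bd (C_graded G n) n.+1).

Lemma top_bd_image (u : singular_cube n.+1 G) :
  ~ injective u -> top_bd (cube_class u) \in image_bd.
Proof.
move=> /degree_ninj u_low; apply/asboolP; apply: top_bd_graded.
by apply: cube_class_degree; lia.
Qed.

(* The filling is [t] with its [k]-th coordinate replaced by [x && ~~ y] for
   two consecutive new coordinates [y], [x]; only the faces [y = 0] and
   [x = 1], which are [t] and its reflection, are possibly injective. *)
Lemma reflect_relation t t' k : t' =1 t \o cube_reflect k ->
  graded_class t + graded_class t' \in image_bd.
Proof.
move=> tt'.
pose i : 'I_n.+1 := widen_ord (leqnSn n) k; pose j := fintype.lift i k.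
have ij : i != j by exact: neq_lift.
have ji : i = fintype.lift j k.
  by apply: val_inj; rewrite /= /bump; lia.
have lift_ij m : m != k -> fintype.lift i m = fintype.lift j m.
  move=> mk; apply: val_inj; rewrite /= /bump.
  by have : (m : nat) != k by []; lia.
pose f (z : bits n.+1) : bits n :=
  [ffun m => if m == k then z j && ~~ z i else z (fintype.lift i m)].
have fE z m : f z m = if m == k then z j && ~~ z i else z (fintype.lift i m).
  by rewrite ffunE.
have [u uE] : exists u : singular_cube n.+1 G, u =1 t \o f.
  apply: singular_cube_comp => x y /cube_adjP[l ->].
  (* Changing coordinate [lift i m] of [z] affects only coordinate [m] of [f z], and changing
     coordinate [i] affects only [k]. *)
  apply: (@cube_adj_off (if unlift i l is Some m then m else k)) => q.
  rewrite !fE !cube_reflectE; case: unliftP => [m ->|->] qm.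
    case: (eqVneq q k) => [qk|_].
      rewrite /j !(inj_eq lift_inj) (negbTE (neq_lift i m)) !addbF.
      by rewrite -qk (negbTE qm) addbF.
    by rewrite (inj_eq lift_inj) (negbTE qm) addbF.
  by rewrite (negbTE qm) eq_sym (negbTE (neq_lift i q)) addbF.
(* Where [z i] holds, [f z] ignores [z j]. *)
have uT l b (z : bits n.+1) : z l = b -> l != j -> z i = true ->
    ~ injective (face l b u).
  move=> zl lj zi; apply: (@face_ninj _ _ _ _ z (cube_reflect j z)) => //.
  - by rewrite cube_reflectE (negbTE lj) addbF.
  - by apply/eqP => /ffunP/(_ j); rewrite cube_reflectE eqxx; case: (z j).
  rewrite !uE /=; congr (t _); apply/ffunP => q; rewrite !fE !cube_reflectE.
  case: (eqVneq q k) => [_|qk]; first by rewrite (negbTE ij) zi !andbF.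
  by rewrite (inj_eq lift_inj) (negbTE qk) addbF.
have u_ninj l b : (l, b) != (i, false) -> (l, b) != (j, true) ->
    ~ injective (face l b u).
  rewrite !xpair_eqE; have [->|lj] := eqVneq l j => /=.
    (* On the facet [z j = 0], [f z] ignores [z i]. *)
    case: b => // _ _; pose z : bits n.+1 := [ffun=> false].
    apply: (@face_ninj _ _ _ _ z (cube_reflect i z)).
    + by rewrite ffunE.
    + by rewrite cube_reflectE ffunE eq_sym (negbTE ij).
    + by apply/eqP => /ffunP/(_ i); rewrite cube_reflectE eqxx; case: (z i).
    rewrite !uE /=; congr (t _); apply/ffunP => q.
    rewrite !fE !cube_reflectE !ffunE.
    case: (eqVneq q k) => _; first by rewrite [j == i]eq_sym (negbTE ij).
    by rewrite eq_sym (negbTE (neq_lift i q)).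
  have [->|li] := eqVneq l i => /=.
    by case: b => // _ _; apply: (@uT _ _ [ffun=> true]); rewrite ?ffunE.
  move=> _ _; apply: (@uT _ _ [ffun q => (q == i) || b]);
    rewrite ?ffunE ?eqxx //.
  by rewrite (negbTE li).
have gc0 l b : (l, b) != (i, false) -> (l, b) != (j, true) ->
    graded_class (face l b u : singular_cube n G) = 0.
  by move=> li lj; apply: graded_class_ninj; apply: u_ninj.
have ut : (face i false u : singular_cube n G) = t.
  apply: singular_cube_eq => y; rewrite (@faceE n.+1) uE /=; congr (t _).
  apply/ffunP => q; rewrite fE cube_ins_at andbT /j !cube_ins_lift.
  by case: (eqVneq q k) => [->|].
have ut' : (face j true u : singular_cube n G) = t'.
  apply: singular_cube_eq => y; rewrite (@faceE n.+1) uE tt' /=; congr (t _).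
  apply/ffunP => q; rewrite fE cube_ins_at cube_reflectE.
  have [->|qk] := eqVneq q k; first by rewrite {1}ji cube_ins_lift addbT.
  by rewrite lift_ij // cube_ins_lift addbF.
have u_folded : ~ injective u.
  pose z : bits n.+1 := [ffun=> true].
  move=> u_inj; have := @uT i true z.
  rewrite ffunE => /(_ erefl ij erefl); apply.
  by move=> x y; rewrite !(@faceE n.+1) => /u_inj/cube_ins_inj.
have bd_u : top_bd (cube_class u) =
    (graded_class t + graded_class t') *~ (-1) ^+ k.+1.
  rewrite top_bd_class -ut -ut'.
  apply: alternating_sum_consecutive => [|l li|l lj].
  - by rewrite /= /bump leqnn.
  - by apply: gc0; rewrite !xpair_eqE ?andbF // (negbTE li).
  - by apply: gc0; rewrite !xpair_eqE ?andbF // (negbTE lj).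
by have := top_bd_image u_folded; rewrite bd_u => /sign_mem.
Qed.

(* [rotate k l] moves every vertex to a neighbour, so that it is the end of a
   homotopy starting at the identity. *)
Definition rotate k l (x : bits n) : bits n :=
  affine (tperm k l) (fdelta k true) x.

Lemma rotateE k l x m : rotate k l x m =
  if m == k then ~~ x l else if m == l then x k else x m.
Proof.
rewrite !ffunE; case: tpermP => [->|->|/eqP/negbTE-> /eqP/negbTE->].
- by rewrite eqxx addbT.
- by case: (eqVneq l k) => [->|_]; rewrite ?eqxx ?addbT ?addbF.
- by rewrite addbF.
Qed.

Lemma rotate_adj k l x : k != l -> cube_adj x (rotate k l x).
Proof.
move=> kl; apply/cube_adjP; exists (if x k == x l then k else l).
apply/ffunP => m; rewrite cube_reflectE rotateE; case: (eqVneq m k) => [->|mk].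
  case: (eqVneq (x k) (x l)) => [->|]; rewrite ?eqxx ?addbT // (negbTE kl).
  by case: (x k); case: (x l).
case: (eqVneq m l) => [->|ml].
  case: (eqVneq (x k) (x l)) => [->|];
    rewrite ?eqxx ?[l == k]eq_sym ?(negbTE kl) ?addbF //.
  by case: (x k); case: (x l).
by case: ifP; rewrite ?(negbTE mk) ?(negbTE ml) addbF.
Qed.

(** Coordinate 0 of the filling [u] is the time of the homotopy from [t] to [t']; all facets in
    other directions are noninjective and vanish. *)
Lemma rotate_relation t t' k l : k != l -> t' =1 t \o rotate k l ->
  graded_class t - graded_class t' \in image_bd.
Proof.
move=> kl tt'.
pose f (z : bits n.+1) : bits n :=
  if z ord0 then rotate k l (cube_del ord0 z) else cube_del ord0 z.
have fE b y : f (cube_ins ord0 b y) = if b then rotate k l y else y.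
  by rewrite /f cube_ins_at cube_insK.
have [u uE] : exists u : singular_cube n.+1 G, u =1 t \o f.
  apply: singular_cube_comp => x y /cube_adjP[i ->].
  rewrite -(cube_delK (erefl (x ord0))).
  case: (unliftP ord0 i) => [m ->|->].
    rewrite cube_reflect_ins_lift !fE; right.
    by case: (x ord0); [apply: affine_adj|]; apply: cube_adj_reflect.
  rewrite cube_reflect_ins !fE; right.
  by case: (x ord0); [rewrite cube_adj_sym|]; apply: rotate_adj.
have u0 : (face ord0 false u : singular_cube n G) = t.
  by apply: singular_cube_eq => y; rewrite (@faceE n.+1) uE /= fE.
have u1 : (face ord0 true u : singular_cube n G) = t'.
  by apply: singular_cube_eq => y; rewrite (@faceE n.+1) uE tt' /= fE.
have u_ninj i b : i != ord0 -> ~ injective (face i b u).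
  rewrite eq_sym => /unlift_some[m -> _].
  (* Chosen so that [x] and its rotation both have coordinate [m] equal to [b]. The vertices (0,
     [rotate k l x]) and (1, [x]) of this facet then have the same image. *)
  pose x : bits n := [ffun q => (q == l) && (m == k) (+) b].
  have xm : x m = b.
    by rewrite ffunE; case: (eqVneq m k) => [->|]; rewrite ?(negbTE kl) ?andbF.
  have rxm : rotate k l x m = b.
    rewrite rotateE !ffunE eqxx (negbTE kl); case: (eqVneq m k) => [_|mk].
      by rewrite negbK.
    by case: (m == l).
  apply: (@face_ninj _ _ _ _ (cube_ins ord0 false (rotate k l x))
    (cube_ins ord0 true x)).
  - by rewrite cube_ins_lift.
  - by rewrite cube_ins_lift.
  - by apply/eqP => /ffunP/(_ ord0); rewrite !cube_ins_at.
  - by rewrite !uE /= !fE.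
have u_folded : ~ injective u.
  move=> u_inj; apply: (@u_ninj (fintype.lift ord0 k) true) => //.
  by move=> x y; rewrite !(@faceE n.+1) => /u_inj/cube_ins_inj.
have bd_u : top_bd (cube_class u) =
    (graded_class t - graded_class t') *~ (-1) ^+ 1.
  rewrite top_bd_class -u0 -u1.
  apply: (alternating_sum_single (i := ord0)) => i i_neq0.
    by apply: graded_class_ninj; apply: u_ninj.
  by apply: graded_class_ninj; apply: u_ninj.
by have := top_bd_image u_folded; rewrite bd_u => /sign_mem.
Qed.

(** With [t1] the reflection of [t], [t'] is a quarter turn of [t1], and
    [t + t' = (t + t1) - (t1 - t')]. *)
Lemma swap_relation t t' k l : k != l -> t' =1 t \o cube_swap k l ->
  graded_class t + graded_class t' \in image_bd.
Proof.
move=> kl tt'.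
have [t1 t1E] : exists t1 : singular_cube n G, t1 =1 t \o cube_reflect k.
  apply: singular_cube_comp => x y xy; right.
  by rewrite !affine_reflect; apply: affine_adj.
have t1_mem := reflect_relation t1E.
have : graded_class t1 - graded_class t' \in image_bd.
  apply: (rotate_relation kl) => x; rewrite /= tt' t1E /=; congr (t _).
  apply/ffunP => m; rewrite cube_reflectE rotateE ffunE.
  case: tpermP => [->|->|/eqP/negbTE-> /eqP/negbTE->]; rewrite ?eqxx ?addbF //.
    by rewrite addbT negbK.
  by rewrite eq_sym (negbTE kl) addbF.
have <- : (graded_class t + graded_class t1) -
    (graded_class t1 - graded_class t') = graded_class t + graded_class t'.
  by rewrite opprB addrACA subrr addr0.
by move=> t1t'; apply: rpredB.
Qed.

Lemma moves_relation s t w : s =1 t \o moves_fun w ->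
  graded_class s - graded_class t *~ (-1) ^+ size w \in image_bd.
Proof.
elim: w t => [|m w IH] t st.
  by rewrite (singular_cube_eq st) mulr1z subrr rpred0.
have [t1 t1E] : exists t1 : singular_cube n G, t1 =1 t \o move_fun m.
  apply: singular_cube_comp => x y xy; right; case: m {st} => [i|i j ij] /=.
    by rewrite !affine_reflect; apply: affine_adj.
  by rewrite !affine_swap; apply: affine_adj.
have t1_mem : graded_class t + graded_class t1 \in image_bd.
  case: m {st} t1E => [i|i j ij]; first exact: reflect_relation.
  by apply: swap_relation; rewrite neq_ltn ij.
have st1 : s =1 t1 \o moves_fun w by move=> x; rewrite st /= t1E.
have := rpredD (IH t1 st1) (rpredMz ((-1) ^+ size w) t1_mem).
by rewrite signed_telescope.
Qed.

Lemma cube_relations_image x :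
  x \in gen_sub (@cube_relations n G) -> x \in image_bd.
Proof.
move=> /gen_subP; apply=> _ [s [t [m [_ _ _ [[w <- st] _] ->]]]].
exact: moves_relation.
Qed.
End Fillings.

(** * Comparison with cellular chains *)

Section Retraction.
Variables (n : nat) (G : graph).

Lemma oriented_cell_moves (s t : singular_cube n G) w :
  s =1 t \o moves_fun w -> oriented_cell s = oriented_cell t *~ (-1) ^+ size w.
Proof.
have [p [c [wpc odd_w]]] := moves_affine w => st.
apply: oriented_cell_eq => D.
rewrite raddfMz /= coeff_oriented_cell -mulrzr.
rewrite (@cell_coef_affine _ _ D s t p c).
  by rewrite odd_w signr_odd mulrC intr_sign.
by move=> x; rewrite st /= wpc.
Qed.

Lemma cell_chain_relations x :
  x \in gen_sub (@cube_relations n G) -> cell_chain x = 0.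
Proof.
move=> xR; apply/eqP; move/gen_subP: xR => /(_ (ker_sub cell_chain)); apply.
move=> _ [s [t [m [_ _ _ [[w <- st] _] ->]]]]; apply/eqP.
rewrite raddfB raddfMz !cell_chainE (oriented_cell_moves st).
by rewrite subrr.
Qed.

(** A section of [cell_chain], which modulo the relations is also a left inverse. *)
Definition ref_chain :
    {additive cellular_chains (CW_box G) n -> C_graded G n n} :=
  top_chain \o proj (D_subcomplex G n) \o
  flift (fun D : CW_cell G n => fgen (ref_cube D)).

Lemma ref_chainE D : ref_chain (fgen D) = graded_class (ref_cube D).
Proof. by rewrite /= fliftE; apply: top_chainE. Qed.

Lemma cell_chain_ref y : cell_chain (ref_chain y) = y.
Proof.
apply/eqP; rewrite -subr_eq0.
pose f : {additive cellular_chains (CW_box G) n ->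
    cellular_chains (CW_box G) n} := (cell_chain \o ref_chain) \- idfun.
have fE z : f z = cell_chain (ref_chain z) - z by [].
rewrite -fE; change (y \in ker_sub f); apply: freeg_sub_ind => D.
change (f (fgen D) == 0); rewrite fE ref_chainE cell_chainE subr_eq0; apply/eqP.
apply: oriented_cell_eq => E.
rewrite /fgen coeffU mul1r /cell_coef image_ref_cube.
have [->|DE] := eqVneq D E.
  rewrite eqxx (@orientationE _ _ _ _ 1%g (ffalse n)) ?affine_odd_id // => x.
  by rewrite /= affine_id.
by rewrite val_eqE (negbTE DE).
Qed.

Lemma bracket_exists (s t : singular_cube n G) w :
  s =1 t \o moves_fun w -> exists m, bracket s t m.
Proof.
move=> st.
have ex_m : exists m, `[< exists2 w, size w = m & s =1 t \o moves_fun w >].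
  by exists (size w); apply/asboolP; exists w.
exists (ex_minn ex_m); case: ex_minnP => m /asboolP[w' w'm w't] m_min.
split; first by exists w'.
by move=> w'' w''t; apply: m_min; apply/asboolP; exists w''.
Qed.

(** On generators: an injective cube is related, with sign, to the reference parametrisation of its
    image, and a noninjective one is zero. *)
Lemma sub_ref_chain_relations x :
  x - ref_chain (cell_chain x) \in gen_sub (@cube_relations n G).
Proof.
pose f : {additive C_graded G n n -> C_graded G n n} :=
  idfun \- (ref_chain \o cell_chain).
have fE z : f z = z - ref_chain (cell_chain z) by [].
rewrite -fE -mem_preim_sub; apply: graded_class_ind => s.
rewrite mem_preim_sub fE cell_chainE.
have [s_inj|s_ninj] := pselect (injective s); last first.
  by rewrite -cell_chainE graded_class_ninj // !raddf0 addr0 rpred0.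
pose D : CW_cell G n := exist _ (image_graph s) (asboolT (image_is_cube s_inj)).
have sD : image_graph s = image_graph (ref_cube D) by rewrite image_ref_cube.
have [p [c spc]] := same_image_affine s_inj (@ref_cube_inj _ _ D) sD.
have [w pcw] := affine_moves p c.
have [m m_bracket] : exists m, bracket s (ref_cube D) m.
  by apply: (@bracket_exists _ _ w) => y; rewrite spc /= pcw.
have [[w' w'm sw'] _] := m_bracket.
have -> : ref_chain (oriented_cell s) = graded_class (ref_cube D) *~ (-1) ^+ m.
  rewrite (oriented_cell_moves sw') w'm raddfMz -cell_chainE -ref_chainE.
  by rewrite cell_chain_ref.
apply: mem_gen_sub; exists s, (ref_cube D), m; split=> //.
exact: ref_cube_inj.
Qed.

Lemma cell_chain_kernel x :
  cell_chain x = 0 -> x \in gen_sub (@cube_relations n G).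
Proof.
by move=> x0; have := sub_ref_chain_relations x; rewrite x0 raddf0 subr0.
Qed.
End Retraction.

Lemma cell_chain_top_bd n G (hG : quasimonophobic n G) x :
  x \in C_subcomplex G n n.+1 -> cell_chain (top_bd x) = 0.
Proof.
pose f : {additive C_complex G n.+1 -> cellular_chains (CW_box G) n} :=
  cell_chain \o top_chain \o bd (C_complex G) n.+1.
have fE z : f z = cell_chain (top_bd z) by [].
rewrite -fE => /gen_subP xP; apply/eqP.
apply: (xP (ker_sub f)) => _ [s [_ s_low ->]].
change (f (cube_class s) == 0); rewrite fE top_bd_class; apply/eqP.
have s_ninj : ~ injective s.
  by move=> /degree_inj sn; move: s_low; rewrite sn; lia.
apply/eqP/freeg_eqP => D; rewrite coeff0 !raddf_sum.
have [D_ind D_quasi] : induced (val D) /\ quasimonophobic_cube n (val D).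
  by apply: hG; apply/asboolP; exact: (valP (D : CW_cell G n)).
(* The minus sign appears because [facet_coef] uses the opposite incidence numbers. *)
transitivity (- \sum_k (facet_coef s D k false + facet_coef s D k true));
  last first.
  by rewrite (folded_boundary D_ind D_quasi s_ninj) oppr0.
rewrite -sumrN.
apply: eq_bigr => i _; rewrite !raddfMz !raddfB !cell_chainE.
rewrite /= !coeff_oriented_cell /facet_coef.
rewrite addbF addbT signrN mulrN -mulrBl signr_odd exprS mulN1r mulrNz.
by rewrite -mulrzr intr_sign.
Qed.

(** Cubes of dimension [n - 1] have degree at most [n - 1], so the graded complex vanishes there. *)
Lemma graded_cycle (n : nat) G (x : C_graded G n n) :
  x \in ker_sub (bd (C_graded G n) n).
Proof.
apply/eqP; case: n x => [|n] x; first exact: bd0.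
have [[y Py] ->] := proj_surj x.
apply/eqP; rewrite [X in X == 0]quot_mapE; last exact: subchain_bd.
rewrite proj_eq0 mem_preim_sub /=.
have -> : n.+1%:Z - 1 = n by lia.
exact: top_degree_full.
Qed.

Theorem theorem5p10 (n : nat) (G : graph) (hG : quasimonophobic n G) :
  (exists phi : {additive homology (C_graded G n) n -> C_mod_sim n G},
     bijective phi /\
     forall z : cycles (C_graded G n) n,
       phi (homology_class z) = sim_class (cycle_val z)) /\
  (exists psi : {additive C_mod_sim n G -> cellular_chains (CW_box G) n},
     bijective psi).
Proof.
split.
  pose f : {additive cycles (C_graded G n) n -> C_mod_sim n G} :=
    sim_class \o cycle_val.
  (* Boundaries have no cellular part, by quasimonophobicity, and the kernel of [cell_chain]
     consists of relations. *)
  have f0 z : z \in boundaries (C_graded G n) n -> f z = 0.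
    rewrite mem_preim_sub => /asboolP[y yz]; apply/eqP; rewrite proj_eq0.
    have [x [x_low yx]] := graded_bdE y.
    apply: cell_chain_kernel; rewrite -[X in cell_chain X]yz yx.
    exact: cell_chain_top_bd.
  exists (quot_lift f0); split; last by move=> z; apply: (quot_liftE f0).
  apply: additive_bijective => [x|y].
    have [z ->] := proj_surj x.
    rewrite [X in X = 0 -> _](quot_liftE f0) => /eqP.
    rewrite proj_eq0 => /cube_relations_image zB; apply/eqP.
    by rewrite proj_eq0 mem_preim_sub.
  have [x ->] := proj_surj y.
  pose z : cycles (C_graded G n) n := exist _ x (graded_cycle x).
  by exists (homology_class z); apply: (quot_liftE f0).
(* [cell_chain] has exactly the relations as kernel and [ref_chain] as section. *)
pose psi := quot_lift (@cell_chain_relations n G); exists psi.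
apply: additive_bijective => [x|y].
  have [u ->] := proj_surj x.
  rewrite [X in X = 0 -> _](quot_liftE (@cell_chain_relations n G)).
  by move=> /cell_chain_kernel uR; apply/eqP; rewrite proj_eq0.
exists (sim_class (ref_chain n G y)).
by rewrite [LHS](quot_liftE (@cell_chain_relations n G)) cell_chain_ref.
Qed.
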